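(* Let $U\subseteq\mathbb{C}^m$ be open and let $f\colon U\to\mathbb{C}$ be a holomorphic function. Set $U_{\mathbb{R}}:=\{(\mathbf{x},\mathbf{y})\in\mathbb{R}^m\times\mathbb{R}^m:\mathbf{x}+i\mathbf{y}\in U\}$ and write $f(\mathbf{x}+i\mathbf{y})=u(\mathbf{x},\mathbf{y})+iv(\mathbf{x},\mathbf{y})$ for $(\mathbf{x},\mathbf{y})\in U_{\mathbb{R}}$, with $u,v\colon U_{\mathbb{R}}\to\mathbb{R}$ real-valued. Then $$\det\big(\theta_1u''(\mathbf{x},\mathbf{y})+\theta_2v''(\mathbf{x},\mathbf{y})\big)=(-1)^m(\theta_1^2+\theta_2^2)^m\,|\det f''(\mathbf{x}+i\mathbf{y})|^2$$ holds for all $\theta_1,\theta_2\in\mathbb{R}$ and all $(\mathbf{x},\mathbf{y})\in U_{\mathbb{R}}$.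
   Context: Here $u''$ and $v''$ denote the $2m\times2m$ real Hessian matrices of $u$ and $v$ with respect to the real variables $(\mathbf{x},\mathbf{y})=(x_1,\dots,x_m,y_1,\dots,y_m)$, and $f''$ denotes the $m\times m$ complex matrix of second order holomorphic partial derivatives $\partial^2f/\partial z_j\partial z_k$. *)

(* Defs.v *)
From mathcomp Require Import all_boot all_order all_algebra.
From mathcomp Require Import all_classical all_reals all_analysis.
From mathcomp Require Import complex.

Set Implicit Arguments.
Unset Strict Implicit.
Unset Printing Implicit Defensive.

Import Order.TTheory GRing.Theory Num.Theory.
Import numFieldNormedType.Exports.

Local Open Scope classical_set_scope.
Local Open Scope ring_scope.

(* For a real field K this is the real Hessian g''; for K = R[i] the quotients
   in 'D_v range over complex increments, so it is the matrix of holomorphic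
   second partial derivatives. *)
Definition hessian (K : numFieldType) (n : nat) (g : 'rV[K]_n -> K)
    (p : 'rV[K]_n) : 'M[K]_n :=
  \matrix_(j < n, k < n) 'D_(delta_mx 0 j) ('D_(delta_mx 0 k) g) p.

(* C^m is 'rV[R[i]^o]_m: the regular module R[i]^o carries the norm topology of
   R[i] and the scaling by R[i], so the differential is C-linear. A function on
   U is represented by a total function whose values off U are irrelevant when
   U is open. *)
Definition holomorphic_on (R : realType) (m : nat)
    (U : set 'rV[R[i]^o]_m) (f : 'rV[R[i]^o]_m -> R[i]^o) : Prop :=
  forall z, U z -> differentiable f z.

(* x + i y; inside complex_scope, a +i* b is the complex number a + i b. *)
Definition complex_row (R : realType) (m : nat) (x y : 'rV[R]_m) :
    'rV[R[i]^o]_m :=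
  \row_(j < m) (x 0 j +i* y 0 j)%C.

(* Main.v *)
Require Import Defs.
From mathcomp Require Import all_boot all_order all_algebra.
From mathcomp Require Import all_classical all_reals all_analysis.
From mathcomp Require Import complex.
From mathcomp Require Import ring lra.

(** Write [a] for the matrix of second holomorphic derivatives of [f] at the
given point. A real derivative of [u] or [v] in a coordinate [x_j] is the real
or imaginary part of the complex derivative in the direction [e_j], and in a
coordinate [y_j] that of the derivative in the direction ['i e_j], which is
['i] times the former. Applying this twice ([hessian_real_part]) shows that
[u''] and [v''] are the block matrices made of the real, respectively
imaginary, parts of [a], ['i a], ['i a] and [- a]. Hence [theta1 u'' + theta2
v''] is the block matrix with rows [(P, - Q)] and [(- Q, - P)], where [P + 'i Q
= (theta1 - 'i theta2) a]. Complex row and column operations make it block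
triangular with diagonal blocks [P + 'i Q] and [- (P - 'i Q)], so its
determinant is [(-1) ^ m |det (P + 'i Q)| ^ 2] ([det_hessian_block]).

The analytic content is that the second derivatives exist at all, since [f] is
only assumed to be complex differentiable once at each point, with no
continuity of the derivative. This is obtained from a bare-hands version of
Cauchy's theory.
- Goursat's theorem for rectangles ([goursat]) is extended to a square with one
  mildly singular point ([rint_punctured]), which gives Cauchy's integral
  formula for the first derivative at the centre of a square
  ([cauchy_derivative]).
- The formula bounds the derivative by the function, then shows that the
  derivative is Lipschitz, so that the remainder of order one is quadratic with
  a constant that depends only on a radius and on a bound of the function
  ([bounded_holo_taylor]).
- For a function of two variables, the formula in one variable is
  differentiated with respect to the other one under the integral sign, the
  quadratic remainder giving the uniformity ([separately_holo_derive]).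
  Restricting [f] to the complex planes through a point gives all the second
  directional derivatives ([holomorphic_derive_derivable]). *)

Set Implicit Arguments.
Unset Strict Implicit.
Unset Printing Implicit Defensive.

Import Order.TTheory GRing.Theory Num.Theory.
Import numFieldNormedType.Exports.

Local Open Scope classical_set_scope.
Local Open Scope ring_scope.

(** * Real-valued modulus and metric criteria on the complex plane *)

Section ComplexNorm.
Variable R : realType.
Local Notation C := (R[i]^o).
Local Notation N := (@Normc.normc R).
Implicit Types z w : C.

Lemma normCE z : `|z| = (N z)%:C%C.
Proof. by case: z. Qed.

Lemma normc_ge0 z : 0 <= N z.
Proof. by case: z => a b /=; exact: sqrtr_ge0. Qed.

Lemma normcB z w : N (z - w) <= N z + N w.
Proof. by rewrite (le_trans (le_normcD _ _))// normcN. Qed.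

Lemma normc_distC z w : N (z - w) = N (w - z).
Proof. by rewrite -normcN opprB. Qed.

Lemma normc_gt0 z : (0 < N z) = (z != 0).
Proof.
rewrite lt_neqAle normc_ge0 andbT eq_sym; congr negb.
by apply/eqP/eqP => [/Normc.eq0_normc//|->]; exact: Normc.normc0.
Qed.

Lemma normc_real (x : R) : N (x%:C)%C = `|x|.
Proof. by rewrite /= expr0n/= addr0 sqrtr_sqr. Qed.

Lemma normc_Re z : `|complex.Re z| <= N z.
Proof. by have := normc_ge_Re z; rewrite normCE lecR. Qed.

Lemma normc_Im z : `|complex.Im z| <= N z.
Proof.
case: z => a b /=; rewrite -sqrtr_sqr ler_wsqrtr// lerDr; exact: sqr_ge0.
Qed.

Lemma normc_le_ReIm z : N z <= `|complex.Re z| + `|complex.Im z|.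
Proof.
case: z => a b /=.
rewrite -ler_sqr ?nnegrE ?sqrtr_ge0 ?addr_ge0// sqr_sqrtr ?addr_ge0 ?sqr_ge0//.
rewrite sqrrD !real_normK ?num_real// -addrA lerD2l lerDr.
by rewrite mulrn_wge0// mulr_ge0.
Qed.

Lemma gt0CE (e : C) : 0 < e -> 0 < complex.Re e /\ e = (complex.Re e)%:C%C.
Proof. by case: e => a b; rewrite ltcE /= => /andP[/eqP -> ->]. Qed.

(** The norm of [R[i]] takes its values in [R[i]] itself; this criterion and the
following ones replace it by the real-valued modulus, for which real
arithmetic is available. *)
Lemma cvgC_distP (T : Type) (F : set_system T) (FF : Filter F) (g : T -> C)
  (l : C) :
  g @ F --> l <-> forall e : R, 0 < e -> \forall t \near F, N (g t - l) < e.
Proof.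
split=> [/cvgrPdist_lt h e e0|h].
- have /h : (0 : C) < e%:C%C by rewrite ltcR.
  apply: filterS => t; rewrite normCE ltcR normc_distC //.
- apply/cvgrPdist_lt => e /gt0CE[e0 ->]; have := h _ e0.
  by apply: filterS => t; rewrite normCE ltcR normc_distC.
Qed.

Lemma nearC_distP (z : C) (P : set C) :
  (\forall w \near z, P w) <->
  exists2 d : R, 0 < d & forall w, N (w - z) < d -> P w.
Proof.
split=> [/nbhs_ballP[/= e /gt0CE[e0 ee] zP]|[d d0 dP]].
- exists (complex.Re e) => // w wz; apply: zP; rewrite /ball/= ee normCE ltcR.
  by rewrite normc_distC.
- apply/nbhs_ballP; exists d%:C%C => /=; first by rewrite ltcR.
  by move=> w; rewrite /ball/= normCE ltcR normc_distC => /dP.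
Qed.

Lemma continuousC_distP (G : C -> C) (z : C) :
  {for z, continuous G} <->
  forall e : R, 0 < e -> exists2 d : R, 0 < d &
    forall w, N (w - z) < d -> N (G w - G z) < e.
Proof.
have H := @cvgC_distP C _ (nbhs_filter z) G (G z).
split=> [/H h e e0|h]; first by have /nearC_distP := h _ e0.
by apply/H => e e0; apply/nearC_distP; exact: h.
Qed.

Lemma continuous_Re : continuous (@complex.Re R : C -> R).
Proof.
move=> z; apply/(@cvgrPdist_lt _ _ _ _ (nbhs_filter z)) => e e0;
  apply/nearC_distP; exists e => // w wz.
by rewrite (le_lt_trans _ wz)// -raddfB normc_distC normc_Re.
Qed.

Lemma continuous_Im : continuous (@complex.Im R : C -> R).
Proof.
move=> z; apply/(@cvgrPdist_lt _ _ _ _ (nbhs_filter z)) => e e0;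
  apply/nearC_distP; exists e => // w wz.
by rewrite (le_lt_trans _ wz)// -raddfB normc_distC normc_Im.
Qed.

Lemma continuous_hline (y : R) : continuous (fun t : R => (t +i* y)%C : C).
Proof.
move=> t; apply/(@cvgC_distP R _ (nbhs_filter t)) => e e0.
have : \forall s \near t, `|t - s| < e by apply/nbhs_ballP; exists e.
apply: filterS => s; apply: le_lt_trans.
by rewrite (le_trans (normc_le_ReIm _))//= subrr normr0 addr0 distrC.
Qed.

Lemma continuous_vline (x : R) : continuous (fun t : R => (x +i* t)%C : C).
Proof.
move=> t; apply/(@cvgC_distP R _ (nbhs_filter t)) => e e0.
have : \forall s \near t, `|t - s| < e by apply/nbhs_ballP; exists e.
apply: filterS => s; apply: le_lt_trans.
by rewrite (le_trans (normc_le_ReIm _))//= subrr normr0 add0r distrC.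
Qed.

End ComplexNorm.

(** * Integrals of complex functions over real segments *)

Section PathIntegral.
Variable R : realType.
Local Notation C := (R[i]^o).
Local Notation N := (@Normc.normc R).
Local Notation mu := (@lebesgue_measure R).
Implicit Types (phi psi : R -> C) (a b t : R).

Definition cint phi a b : C :=
  ((\int[mu]_(t in `[a, b]) complex.Re (phi t))%R +i*
   (\int[mu]_(t in `[a, b]) complex.Im (phi t))%R)%C.

Definition cont_seg phi a b :=
  forall t, a <= t <= b -> {for t, continuous phi}.

Lemma cont_segB phi psi a b : cont_seg phi a b -> cont_seg psi a b ->
  cont_seg (fun t => phi t - psi t) a b.
Proof. by move=> h k t tab; apply: continuousB; [exact: h|exact: k]. Qed.

Lemma cont_segZ c phi a b : cont_seg phi a b ->
  cont_seg (fun t => c * phi t) a b.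
Proof. by move=> h t tab; apply: continuousM; [exact: cvg_cst|exact: h]. Qed.

Lemma integrable_continuous (g : R -> R) a b :
  (forall t, a <= t <= b -> {for t, continuous g}) ->
  mu.-integrable `[a, b] (EFin \o g).
Proof.
move=> h; apply: continuous_compact_integrable; first exact: segment_compact.
by apply: continuous_in_subspaceT => t; rewrite inE/= in_itv/= => /h.
Qed.

Lemma cont_seg_Re phi a b : cont_seg phi a b ->
  forall t, a <= t <= b -> {for t, continuous (fun t => complex.Re (phi t))}.
Proof. by move=> h t /h ht; apply: continuous_comp ht _;
  exact: continuous_Re. Qed.

Lemma cont_seg_Im phi a b : cont_seg phi a b ->
  forall t, a <= t <= b -> {for t, continuous (fun t => complex.Im (phi t))}.
Proof. by move=> h t /h ht; apply: continuous_comp ht _;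
  exact: continuous_Im. Qed.

Lemma integrable_Re phi a b : cont_seg phi a b ->
  mu.-integrable `[a, b] (EFin \o (fun t => complex.Re (phi t))).
Proof. by move=> h; apply: integrable_continuous; exact: cont_seg_Re. Qed.

Lemma integrable_Im phi a b : cont_seg phi a b ->
  mu.-integrable `[a, b] (EFin \o (fun t => complex.Im (phi t))).
Proof. by move=> h; apply: integrable_continuous; exact: cont_seg_Im. Qed.

Lemma eq_cint phi psi a b : (forall t, a <= t <= b -> phi t = psi t) ->
  cint phi a b = cint psi a b.
Proof.
by move=> h; congr Complex; apply: eq_Rintegral => t;
  rewrite inE/= in_itv/= => /h ->.
Qed.

Lemma cintB phi psi a b : cont_seg phi a b -> cont_seg psi a b ->
  cint (fun t => phi t - psi t) a b = cint phi a b - cint psi a b.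
Proof.
move=> h k; apply/eqP; rewrite eq_complex /= -!RintegralB//;
  do ?[exact: integrable_Re|exact: integrable_Im].
apply/andP; split; apply/eqP; apply: eq_Rintegral => t _; exact: raddfB.
Qed.

Lemma cintZ c phi a b : cont_seg phi a b ->
  cint (fun t => c * phi t) a b = c * cint phi a b.
Proof.
move=> h; have iR := integrable_Re h; have iI := integrable_Im h.
case: c => x y; apply/eqP; rewrite eq_complex /=.
have mI : measurable (`[a, b]%classic : set R) by exact: measurable_itv.
have iZ r (g : R -> R) : (forall t, a <= t <= b -> {for t, continuous g}) ->
    mu.-integrable `[a, b] (EFin \o (fun t => r * g t)).
  move=> cg; apply: integrable_continuous => t tab.
  by apply: continuousM; [exact: cvg_cst|exact: cg].
have cR := cont_seg_Re h; have cI := cont_seg_Im h.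
rewrite -!RintegralZl// -RintegralB//; do ?exact: iZ.
rewrite -RintegralD//; do ?exact: iZ.
by apply/andP; split; apply/eqP; apply: eq_Rintegral => t _; case: (phi t).
Qed.

Lemma Rintegral_segment_cst (r : R) a b : a <= b ->
  (\int[mu]_(t in `[a, b]) r)%R = r * (b - a).
Proof.
move=> ab; rewrite (Rintegral_cst mu (measurable_itv `[a, b]) r); congr (_ * _).
have E : mu `[a, b]%classic = if a < b then (b - a)%:E else 0%E.
  by rewrite lebesgue_measure_itv/= lte_fin.
apply: (etrans (congr1 fine E)).
by move: ab; rewrite le_eqVlt => /predU1P[->|->]//; rewrite ltxx subrr.
Qed.

Lemma cint_cst c a b : a <= b -> cint (fun=> c) a b = c * (b - a)%:C%C.
Proof.
move=> ab; apply/eqP; rewrite eq_complex/= !Rintegral_segment_cst//.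
by case: c => x y /=; rewrite !mulr0 subr0 add0r !eqxx.
Qed.

Lemma cint_split phi a b c : a <= b <= c -> cont_seg phi a c ->
  cint phi a c = cint phi a b + cint phi b c.
Proof.
move=> /andP[ab bc] h.
have H (g : R -> R) : mu.-integrable `[a, c] (EFin \o g) ->
   \int[mu]_(t in `[a, c]) g t =
   (\int[mu]_(t in `[a, b]) g t + \int[mu]_(t in `[b, c]) g t)%R.
  move=> ig; apply/eqP; rewrite addrC -subr_eq; apply/eqP.
  rewrite (Rintegral_itvB ig) ?bnd_simp// Rintegral_itv_obnd_cbnd//.
  by apply: integrableS ig => //; apply: subset_itvr; rewrite bnd_simp.
apply/eqP; rewrite eq_complex/= !H ?eqxx//;
  [exact: integrable_Im|exact: integrable_Re].
Qed.

(** The factor 2 comes from bounding the real and imaginary parts separately. *)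
Lemma cint_bound phi a b (K : R) : a <= b -> cont_seg phi a b ->
  (forall t, a <= t <= b -> N (phi t) <= K) ->
  N (cint phi a b) <= 2 * K * (b - a).
Proof.
move=> ab h hK.
have H (g : R -> R) : (forall t, a <= t <= b -> {for t, continuous g}) ->
    (forall t, a <= t <= b -> `|g t| <= K) ->
    `|\int[mu]_(t in `[a, b]) g t| <= K * (b - a).
  move=> cg gK; have ig := integrable_continuous cg.
  rewrite (le_trans (le_normr_Rintegral _ ig))//.
  rewrite -Rintegral_segment_cst//; apply: le_Rintegral => //.
  - apply: integrable_continuous => t /cg gt.
    by apply: continuous_comp gt _; exact: norm_continuous.
  - by apply: integrable_continuous => t _; exact: cvg_cst.
rewrite (le_trans (normc_le_ReIm _))//= -mulrA mulr_natl mulr2n lerD//;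
  apply: H.
- exact: cont_seg_Re.
- by move=> t /hK; apply: le_trans; exact: normc_Re.
- exact: cont_seg_Im.
- by move=> t /hK; apply: le_trans; exact: normc_Im.
Qed.

End PathIntegral.

(** * Metric form of differentiability *)

Section Derivative.
Variable R : realType.
Local Notation C := (R[i]^o).
Local Notation N := (@Normc.normc R).

Lemma cvg_dnbhs0C_distP (q : C -> C) (l : C) :
  q h @[h --> 0^'] --> l <->
  forall e : R, 0 < e -> exists2 d : R, 0 < d &
    forall h, h != 0 -> N h < d -> N (q h - l) < e.
Proof.
have H := @cvgC_distP R C _ (dnbhs_filter (0 : C)) q l.
split=> [/H h e e0|h].
  have /nearC_distP[d d0 hd] := h e e0; exists d => // t t0 td.
  by apply: hd => //; rewrite subr0.
apply/H => e e0; have [d d0 hd] := h e e0.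
by apply/nearC_distP; exists d => // t; rewrite subr0 => td t0; exact: hd.
Qed.

Lemma derivable_remainder (V : normedModType R[i]) (G : V -> C) (z v : V) :
  derivable G z v -> forall e : R, 0 < e -> exists2 d : R, 0 < d &
  forall h : C, N h < d -> N (G (h *: v + z) - G z - h * 'D_v G z) <= e * N h.
Proof.
move=> /cvg_dnbhs0C_distP dG e /dG[d d0 hd]; exists d => // h hd'.
have [->|h0] := eqVneq h 0.
  by rewrite scale0r add0r subrr mul0r subrr Normc.normc0 mulr0.
have := ltW (hd h h0 hd').
have -> : G (h *: v + z) - G z - h * 'D_v G z =
   ((h^-1 *: (G (h *: v + z) - G z)) - 'D_v G z) * h.
  by rewrite -[_^-1 *: _]/(_^-1 * _); field.
by rewrite Normc.normcM => hN; rewrite ler_wpM2r// normc_ge0.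
Qed.

(** A derivative is a [lim], which takes a default value when the quotient does
not converge; hence the limit has to be exhibited. *)
Lemma derive_unique (V : normedModType R[i]) (G : V -> C) (z v : V) (l : C) :
  (forall e : R, 0 < e -> exists2 d : R, 0 < d &
    forall h : C, h != 0 -> N h < d ->
      N (h^-1 * (G (h *: v + z) - G z) - l) < e) ->
  'D_v G z = l.
Proof. by move=> /cvg_dnbhs0C_distP H; apply: cvg_lim. Qed.

Lemma derivableC_remainder (G : C -> C) (z : C) :
  derivable G z 1 -> forall e : R, 0 < e -> exists2 d : R, 0 < d &
  forall w : C, N (w - z) < d ->
    N (G w - G z - (w - z) * 'D_1 G z) <= e * N (w - z).
Proof.
move=> /derivable_remainder dG e /dG[d d0 hd]; exists d => // w /hd.
by rewrite (_ : (w - z) *: 1 + z = w)// [_ *: _]mulr1 subrK.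
Qed.

Lemma derivableC_continuous (G : C -> C) (z : C) :
  derivable G z 1 -> {for z, continuous G}.
Proof. by move=> /derivable1_diffP/differentiable_continuous. Qed.

End Derivative.

(** * Contour integrals along the boundary of a rectangle *)

Section RectangleIntegral.
Variable R : realType.
Local Notation C := (R[i]^o).
Local Notation N := (@Normc.normc R).
Implicit Types (G H : C -> C) (x y : R).

(** Both pairs of opposite sides are grouped into one integral each. In this
form the integrand is constant when [G] is affine, so that affine functions
are seen to integrate to zero without computing any primitive. *)
Definition rint G x0 x1 y0 y1 : C :=
  cint (fun t => G (t +i* y0)%C - G (t +i* y1)%C) x0 x1 +
  'i%C * cint (fun t => G (x1 +i* t)%C - G (x0 +i* t)%C) y0 y1.

Local Notation cont_hseg G y x0 x1 := (cont_seg (fun t => G (t +i* y)%C) x0 x1).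
Local Notation cont_vseg G x y0 y1 := (cont_seg (fun t => G (x +i* t)%C) y0 y1).

Definition on_edge x0 x1 y0 y1 (z : C) :=
  let: (x +i* y)%C := z in
  [/\ x0 <= x <= x1, y0 <= y <= y1 &
      [\/ x = x0, x = x1, y = y0 | y = y1]].

Definition cont_edges G x0 x1 y0 y1 :=
  forall z, on_edge x0 x1 y0 y1 z -> {for z, continuous G}.

Lemma cont_hsegP G y x0 x1 :
  (forall x, x0 <= x <= x1 -> {for (x +i* y)%C, continuous G}) -> cont_hseg G y
    x0 x1.
Proof.
move=> h t /h; apply: (@continuous_comp _ _ _ (fun t : R => (t +i* y)%C : C)).
exact: continuous_hline.
Qed.

Lemma cont_vsegP G x y0 y1 :
  (forall y, y0 <= y <= y1 -> {for (x +i* y)%C, continuous G}) -> cont_vseg G x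
    y0 y1.
Proof.
move=> h t /h; apply: (@continuous_comp _ _ _ (fun t : R => (x +i* t)%C : C)).
exact: continuous_vline.
Qed.

Lemma cont_edges_segs G x0 x1 y0 y1 : x0 <= x1 -> y0 <= y1 ->
  cont_edges G x0 x1 y0 y1 ->
  [/\ cont_hseg G y0 x0 x1, cont_hseg G y1 x0 x1,
      cont_vseg G x0 y0 y1 & cont_vseg G x1 y0 y1].
Proof.
move=> xx yy h; split.
- by apply: cont_hsegP => x xs; apply: h; split; rewrite ?lexx//; constructor.
- by apply: cont_hsegP => x xs; apply: h; split; rewrite ?lexx ?yy//;
  constructor.
- by apply: cont_vsegP => x xs; apply: h; split; rewrite ?lexx ?yy//;
  constructor.
- by apply: cont_vsegP => x xs; apply: h; split; rewrite ?lexx ?xx//;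
  constructor.
Qed.

Lemma eq_rint G H x0 x1 y0 y1 : x0 <= x1 -> y0 <= y1 ->
  (forall z, on_edge x0 x1 y0 y1 z -> G z = H z) ->
  rint G x0 x1 y0 y1 = rint H x0 x1 y0 y1.
Proof.
move=> xx yy GH; congr (_ + _ * _); apply: eq_cint => t ts; congr (_ - _);
  apply: GH; split; rewrite ?lexx ?xx ?yy //; by constructor.
Qed.

Lemma rintB G H x0 x1 y0 y1 : x0 <= x1 -> y0 <= y1 ->
  cont_edges G x0 x1 y0 y1 -> cont_edges H x0 x1 y0 y1 ->
  rint (fun z => G z - H z) x0 x1 y0 y1 =
  rint G x0 x1 y0 y1 - rint H x0 x1 y0 y1.
Proof.
move=> xx yy /cont_edges_segs-/(_ xx yy)[g1 g2 g3 g4].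
move=> /cont_edges_segs-/(_ xx yy)[h1 h2 h3 h4].
rewrite /rint (cintB (cont_segB g1 h1) (cont_segB g2 h2)).
rewrite (cintB (cont_segB g4 h4) (cont_segB g3 h3)) (cintB g1 h1) (cintB g2 h2).
rewrite (cintB g3 h3) (cintB g4 h4) (cintB g1 g2) (cintB h1 h2) (cintB g4 g3)
  (cintB h4 h3).
ring.
Qed.

Lemma rintZ c G x0 x1 y0 y1 : x0 <= x1 -> y0 <= y1 ->
  cont_edges G x0 x1 y0 y1 ->
  rint (fun z => c * G z) x0 x1 y0 y1 = c * rint G x0 x1 y0 y1.
Proof.
move=> xx yy /cont_edges_segs-/(_ xx yy)[g1 g2 g3 g4].
rewrite /rint (cintB (cont_segZ (c:=c) g1) (cont_segZ (c:=c) g2)).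
rewrite (cintB (cont_segZ (c:=c) g4) (cont_segZ (c:=c) g3)) (cintB g1 g2)
  (cintB g4 g3).
rewrite (cintZ c g1) (cintZ c g2) (cintZ c g3) (cintZ c g4).
ring.
Qed.

Lemma rint_bound G x0 x1 y0 y1 (K : R) : x0 <= x1 -> y0 <= y1 ->
  cont_edges G x0 x1 y0 y1 ->
  (forall z, on_edge x0 x1 y0 y1 z -> N (G z) <= K) ->
  N (rint G x0 x1 y0 y1) <= 4 * K * ((x1 - x0) + (y1 - y0)).
Proof.
move=> xx yy /cont_edges_segs-/(_ xx yy)[g1 g2 g3 g4] GK.
rewrite (le_trans (le_normcD _ _))// Normc.normcM.
have -> : N 'i%C = 1 by rewrite /= expr0n expr1n add0r sqrtr1.
have E (p q : R) : 4 * K * (p + q) = 2 * (K + K) * p + 2 * (K + K) * q by ring.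
rewrite mul1r.
rewrite E.
apply: lerD.
- apply: (@cint_bound R _ x0 x1 (K + K) xx).
    exact: cont_segB g1 g2.
  move=> t ts; rewrite (le_trans (normcB _ _))//; apply: lerD; apply: GK;
    split; rewrite ?lexx ?yy//; by constructor.
- apply: (@cint_bound R _ y0 y1 (K + K) yy).
    exact: cont_segB g4 g3.
  move=> t ts; rewrite (le_trans (normcB _ _))//; apply: lerD; apply: GK;
    split; rewrite ?lexx ?xx//; by constructor.
Qed.

(** On opposite sides an affine function differs by a constant, and the
contributions of the horizontal and of the vertical pair of sides cancel. *)
Lemma rint_affine (c d : C) x0 x1 y0 y1 : x0 <= x1 -> y0 <= y1 ->
  rint (fun z => c + z * d) x0 x1 y0 y1 = 0.
Proof.
move=> xx yy; rewrite /rint.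
rewrite (@eq_cint _ _ (fun=> (0 +i* (y0 - y1))%C * d)); last first.
  move=> t _; rewrite opprD addrACA subrr add0r -mulrBl; congr (_ * _).
  by rewrite /= -[X in _ = X]/(0 +i* (y0 - y1))%C; apply/eqP;
    rewrite eq_complex /= subrr !eqxx.
rewrite (@eq_cint _ (fun t => c + (x1 +i* t)%C * d - _) (fun=> ((x1 - x0) +i*
  0)%C * d)); last first.
  move=> t _; rewrite opprD addrACA subrr add0r -mulrBl; congr (_ * _).
  by apply/eqP; rewrite eq_complex /= subrr !eqxx.
rewrite !cint_cst//; case: d => p q.
by apply/eqP; rewrite eq_complex /=; apply/andP; split; apply/eqP; ring.
Qed.

Lemma rint_splitx G x0 xm x1 y0 y1 : x0 <= xm <= x1 -> y0 <= y1 ->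
  cont_edges G x0 xm y0 y1 -> cont_edges G x0 x1 y0 y1 ->
  rint G x0 x1 y0 y1 = rint G x0 xm y0 y1 + rint G xm x1 y0 y1.
Proof.
move=> /andP[x0m xm1] yy; have xx := le_trans x0m xm1.
move=> /cont_edges_segs-/(_ x0m yy)[_ _ _ gm].
move=> /cont_edges_segs-/(_ xx yy)[g1 g2 g3 g4].
have xm' : x0 <= xm <= x1 by rewrite x0m.
rewrite /rint (cint_split xm' (cont_segB g1 g2)) (cintB g4 g3) (cintB gm g3)
  (cintB g4 gm).
ring.
Qed.

Lemma rint_splity G x0 x1 y0 ym y1 : x0 <= x1 -> y0 <= ym <= y1 ->
  cont_edges G x0 x1 y0 ym -> cont_edges G x0 x1 y0 y1 ->
  rint G x0 x1 y0 y1 = rint G x0 x1 y0 ym + rint G x0 x1 ym y1.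
Proof.
move=> xx /andP[y0m ym1]; have yy := le_trans y0m ym1.
move=> /cont_edges_segs-/(_ xx y0m)[_ gm _ _].
move=> /cont_edges_segs-/(_ xx yy)[g1 g2 g3 g4].
have ym' : y0 <= ym <= y1 by rewrite y0m.
rewrite /rint (cint_split ym' (cont_segB g4 g3)) (cintB g1 g2) (cintB gm g2)
  (cintB g1 gm).
ring.
Qed.

End RectangleIntegral.

(** * Goursat's theorem on rectangles *)

Section Goursat.
Variable R : realType.
Local Notation C := (R[i]^o).
Local Notation N := (@Normc.normc R).
Implicit Types (G H : C -> C) (x y : R).

(** Provides each coordinate of the limit point of the repeated quartering. *)
Lemma nested_segments (u : nat -> R) (a : R) :
  (forall n, u n <= u n.+1 /\ u n.+1 + a / 2 ^+ n.+1 <= u n + a / 2 ^+ n) ->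
  0 <= a -> exists l, forall n, u n <= l <= u n + a / 2 ^+ n.
Proof.
move=> hu a0.
have up n k : u n <= u (n + k)%N.
  by elim: k => [|k /le_trans->//]; rewrite ?addn0// addnS;
    case: (hu (n + k)%N).
have dn n k : u (n + k)%N + a / 2 ^+ (n + k) <= u n + a / 2 ^+ n.
  by elim: k => [|k]; [rewrite addn0|rewrite addnS; apply: le_trans;
    case: (hu (n + k)%N)].
have p0 n : 0 <= a / 2 ^+ n by rewrite divr_ge0// exprn_ge0.
have ub n : ubound (range u) (u n + a / 2 ^+ n).
  move=> _ [k _ <-]; have [nk|/ltnW kn] := leqP n k.
    by rewrite -(subnKC nk) (le_trans _ (dn n (k - n)%N))// lerDl.
  by rewrite -[X in u X + _](subnKC kn) (le_trans (up k (n - k)%N))// lerDl.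
exists (sup (range u)) => n; apply/andP; split.
  apply: ub_le_sup; last by exists n.
  by exists (u 0%N + a / 2 ^+ 0); exact: ub.
by apply: ge_sup; [exists (u n); exists n|exact: ub].
Qed.

Definition rect_holo G x0 x1 y0 y1 := forall x y,
  x0 <= x <= x1 -> y0 <= y <= y1 -> derivable G (x +i* y)%C 1.

Lemma rect_holo_edges G x0 x1 y0 y1 x0' x1' y0' y1' :
  rect_holo G x0 x1 y0 y1 -> x0 <= x0' -> x1' <= x1 -> y0 <= y0' -> y1' <= y1 ->
  cont_edges G x0' x1' y0' y1'.
Proof.
move=> h a b c d [x y] [/andP[xx xx'] /andP[yy yy'] _].
apply: derivableC_continuous; apply: h.
  by rewrite (le_trans a)//= (le_trans _ b).
by rewrite (le_trans c)//= (le_trans _ d).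
Qed.

(** The four quarters share their inner sides with opposite orientations, so the
boundary integrals add up, and one of them carries at least a quarter of the
total modulus. *)
Lemma rint_quarter G x y a b (K : R) : 0 <= a -> 0 <= b ->
  rect_holo G x (x + a) y (y + b) -> K <= N (rint G x (x + a) y (y + b)) ->
  exists x' y', [/\ x' = x \/ x' = x + a / 2, y' = y \/ y' = y + b / 2 &
    K / 4 <= N (rint G x' (x' + a / 2) y' (y' + b / 2))].
Proof.
move=> a0 b0 hG hK.
have ex : x + a / 2 + a / 2 = x + a by lra.
have ey : y + b / 2 + b / 2 = y + b by lra.
have xm : x <= x + a / 2 <= x + a by lra.
have ym : y <= y + b / 2 <= y + b by lra.
have [x1 x2] := andP xm; have [y1 y2] := andP ym.
have E x0' x1' y0' y1' : x <= x0' -> x1' <= x + a -> y <= y0' -> y1' <= y + b ->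
  cont_edges G x0' x1' y0' y1' by move=> *; exact: (rect_holo_edges hG).
have xx := le_trans x1 x2; have yy := le_trans y1 y2.
have S0 : rint G x (x + a) y (y + b) =
    rint G x (x + a / 2) y (y + b) + rint G (x + a / 2) (x + a) y (y + b).
  by apply: rint_splitx => //; apply: E.
have S1 : rint G x (x + a / 2) y (y + b) =
    rint G x (x + a / 2) y (y + b / 2) + rint G x (x + a / 2) (y + b / 2) (y +
      b).
  by apply: rint_splity => //; apply: E.
have S2 : rint G (x + a / 2) (x + a) y (y + b) =
    rint G (x + a / 2) (x + a) y (y + b / 2) + rint G (x + a / 2) (x + a) (y +
      b / 2) (y + b).
  by apply: rint_splity => //; apply: E.
move: hK; rewrite S0 S1 S2 => hK.
have {}hK := le_trans hK (le_trans (le_normcD _ _) (lerD (le_normcD _ _)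
  (le_normcD _ _))).
have [h|h1] := leP (K / 4) (N (rint G x (x + a / 2) y (y + b / 2))).
  by exists x, y; split; [left|left|].
have [h|h2] := leP (K / 4) (N (rint G x (x + a / 2) (y + b / 2) (y + b))).
  by exists x, (y + b / 2); rewrite ey; split; [left|right|].
have [h|h3] := leP (K / 4) (N (rint G (x + a / 2) (x + a) y (y + b / 2))).
  by exists (x + a / 2), y; rewrite ex; split; [right|left|].
exists (x + a / 2), (y + b / 2); rewrite ex ey; split; [by right|by right|].
move: hK h1 h2 h3; move: (N _) (N _) (N _) (N _) => n1 n2 n3 n4; clear; lra.
Qed.

(** If the integral were nonzero, repeated quartering would produce
rectangles shrinking to a point on which the integral decreases at most like
their area. Near that point [G] differs from an affine function, which
integrates to zero, by an error that is small with respect to the diameter;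
hence the integral is small with respect to the area, a contradiction. *)
Lemma goursat G x0 x1 y0 y1 : x0 <= x1 -> y0 <= y1 ->
  rect_holo G x0 x1 y0 y1 -> rint G x0 x1 y0 y1 = 0.
Proof.
move=> xx yy hG; apply: Normc.eq0_normc; apply/eqP;
  rewrite eq_le normc_ge0 andbT.
rewrite leNgt; apply/negP; set K := N _ => K0.
pose a := x1 - x0; pose b := y1 - y0.
have a0 : 0 <= a by rewrite subr_ge0. have b0 : 0 <= b by rewrite subr_ge0.
pose A n : R := a / 2 ^+ n; pose B n : R := b / 2 ^+ n.
have A0 n : 0 <= A n by rewrite divr_ge0// exprn_ge0.
have B0 n : 0 <= B n by rewrite divr_ge0// exprn_ge0.
have AS n : A n.+1 = A n / 2 by rewrite /A exprSr invfM mulrA.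
have BS n : B n.+1 = B n / 2 by rewrite /B exprSr invfM mulrA.
pose good (p : nat * (R * R)) := [/\ x0 <= p.2.1, p.2.1 + A p.1 <= x1,
  y0 <= p.2.2, p.2.2 + B p.1 <= y1 &
  K / 4 ^+ p.1 <= N (rint G p.2.1 (p.2.1 + A p.1) p.2.2 (p.2.2 + B p.1))].
pose next (p q : nat * (R * R)) := q.1 = p.1.+1 /\ (good p -> [/\ good q,
  p.2.1 <= q.2.1, q.2.1 + A q.1 <= p.2.1 + A p.1,
  p.2.2 <= q.2.2 & q.2.2 + B q.1 <= p.2.2 + B p.1]).
have step p : {q | next p q}.
  apply: cid; case: p => n [x y].
  have [gp|ngp] := pselect (good (n, (x, y))); last by exists (n.+1, (x, y));
    split.
  have [/= g1 g2 g3 g4 g5] := gp.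
  have hG' : rect_holo G x (x + A n) y (y + B n).
    by move=> s t /andP[s1 s2] /andP[t1 t2]; apply: hG; lra.
  have [x' [y' [hx' hy' h]]] := rint_quarter (A0 n) (B0 n) hG' g5.
  exists (n.+1, (x', y')); split => // _; rewrite /good /= AS BS.
  have := A0 n; have := B0 n => Bn An.
  have Hx : x <= x' /\ x' + A n / 2 <= x + A n by clear -hx' An;
    case: hx' => ->; split; lra.
  have Hy : y <= y' /\ y' + B n / 2 <= y + B n by clear -hy' Bn;
    case: hy' => ->; split; lra.
  have h' : K / 4 ^+ n.+1 <= N (rint G x' (x' + A n / 2) y' (y' + B n / 2)).
    by rewrite exprSr invfM mulrA.
  case: Hx Hy => ? ? [? ?]; split => //; split => //.
  - exact: le_trans g1 _.
  - exact: le_trans g2.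
  - exact: le_trans g3 _.
  - exact: le_trans g4.
have [s [s0 sS]] := dependent_choice step (0%N, (x0, y0)).
have sn n : (s n).1 = n by elim: n => [|n IH]; [rewrite s0|case: (sS n) => ->;
  rewrite IH].
have gs n : good (s n).
  elim: n => [|n IH]; last by case: (sS n) => _ /(_ IH)[].
  rewrite s0 /good /= /A /B expr0 !divr1 /a /b.
  by rewrite (addrC x0) (addrC y0) !subrK; split.
have [lx hlx] : exists l, forall n, (s n).2.1 <= l <= (s n).2.1 + a / 2 ^+ n.
  apply: nested_segments => // n; have [_ /(_ (gs n))[_ + + _ _]] := sS n.
  by rewrite !sn.
have [ly hly] : exists l, forall n, (s n).2.2 <= l <= (s n).2.2 + b / 2 ^+ n.
  apply: nested_segments => // n; have [_ /(_ (gs n))[_ _ _ + +]] := sS n.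
  by rewrite !sn.
have dz : derivable G (lx +i* ly)%C 1.
  have := hlx 0%N; have := hly 0%N; rewrite s0 /= expr0 !divr1 /a /b => l1 l2.
  by apply: hG; lra.
(* The bound obtained below is [4 * (a + b) ^+ 2 * eps / 4 ^+ n]; taking
   [eps = K / M] makes it smaller than [K / 4 ^+ n], even when [a + b = 0]. *)
pose M : R := 4 * (a + b) ^+ 2 + 1.
have M0 : 0 < M by rewrite ltr_wpDl// mulr_ge0// sqr_ge0.
have e0 : 0 < K / M by rewrite divr_gt0.
have [d d0 hd] := derivableC_remainder dz e0.
(* A rectangle of the sequence that lies in the disc where [G] is close to its
   affine approximation. *)
have [n hn] : exists n, A n + B n < d.
  have : (fun n : nat => (a + b) * (2^-1) ^+ n) @ \oo --> (a + b) * 0.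
    apply: cvgM; first exact: cvg_cst.
    by apply: cvg_expr; rewrite ger0_norm ?invr_ge0// invf_lt1// ltr1n.
  rewrite mulr0 => /cvgr0_norm_lt/(_ d d0)[n _ /(_ n (leqnn n))] /= h.
  exists n; rewrite /A /B -mulrDl -exprVn; apply: le_lt_trans h;
    exact: ler_norm.
have [g1 g2 g3 g4] := gs n; rewrite sn in g2 g4 *.
set x := (s n).2.1 in g1 g2 g3 g4 *; set y := (s n).2.2 in g1 g2 g3 g4 *.
have An := A0 n; have Bn := B0 n.
set z : C := (lx +i* ly)%C in dz hd.
have near w : on_edge x (x + A n) y (y + B n) w -> N (w - z) <= A n + B n.
  case: w => p q [p1 p2 _]; have := hlx n; have := hly n;
    rewrite -/x -/y -/(A n) -/(B n).
  move=> l1 l2; rewrite (le_trans (normc_le_ReIm _))//=; apply: lerD;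
    rewrite ler_norml; lra.
have xn : x <= x + A n by rewrite lerDl.
have yn : y <= y + B n by rewrite lerDl.
pose L w : C := (G z - z * 'D_1 G z) + w * 'D_1 G z.
have cG : cont_edges G x (x + A n) y (y + B n) by exact: (rect_holo_edges hG).
have cL : cont_edges L x (x + A n) y (y + B n).
  move=> w _; apply: (@cvgD C C C (nbhs w) _ (cst _) ( *%R^~ _)).
    exact: cvg_cst.
  by apply: (@cvgM C C (nbhs w) _ id (cst _)); [exact: cvg_id|exact: cvg_cst].
have L0 : rint L x (x + A n) y (y + B n) = 0 by exact: rint_affine.
have := rintB xn yn cG cL; rewrite L0 subr0 => <- gK.
have : N (rint (fun w => G w - L w) x (x + A n) y (y + B n)) <=
    4 * (K / M * (A n + B n)) * ((x + A n - x) + (y + B n - y)).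
  apply: (rint_bound xn yn).
    by move=> w hw; apply: continuousB; [exact: cG|exact: cL].
  move=> w hw; have wz := near w hw.
  have -> : G w - L w = G w - G z - (w - z) * 'D_1 G z by rewrite /L; ring.
  apply: (le_trans (hd _ (le_lt_trans wz hn))); apply: ler_wpM2l wz; exact: ltW.
move=> /(le_trans gK).
have -> : 4 * (K / M * (A n + B n)) * (x + A n - x + (y + B n - y)) =
  (4 * (a + b) ^+ 2 / M) * (K / 4 ^+ n).
  have -> : 4 ^+ n = 2 ^+ n * 2 ^+ n :> R by rewrite -exprMn; congr (_ ^+ _);
    ring.
  have M1 : M != 0 by rewrite gt_eqF.
  have p1 : 2 ^+ n != 0 :> R by rewrite expf_neq0// pnatr_eq0.
  by rewrite /A /B; clear -M1 p1; move: M (2 ^+ n) M1 p1 => M' p M1 p1; field;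
    rewrite M1 p1.
apply/negP; rewrite -ltNge gtr_pMl; last by rewrite divr_gt0// exprn_gt0.
by rewrite ltr_pdivrMr// mul1r /M ltrDl.
Qed.

End Goursat.

(** * Cauchy's integral formula for the derivative *)

Section CauchyKernel.
Variable R : realType.
Local Notation C := (R[i]^o).
Local Notation N := (@Normc.normc R).
Implicit Types (G H : C -> C) (x y r : R).

Lemma cint_Re_ge (phi : R -> C) a b (k : R) : a <= b -> cont_seg phi a b ->
  (forall t, a <= t <= b -> k <= complex.Re (phi t)) ->
  k * (b - a) <= complex.Re (cint phi a b).
Proof.
move=> ab h hk; rewrite /= -Rintegral_segment_cst//; apply: le_Rintegral => //.
- by apply: integrable_continuous => t _; exact: cvg_cst.
- exact: integrable_Re.
Qed.

Lemma on_square_edge_norm r z : 0 < r -> on_edge (- r) r (- r) r z ->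
  r <= N z <= 2 * r.
Proof.
case: z => x y r0 [/andP[x1 x2] /andP[y1 y2] h]; apply/andP; split; last first.
  by rewrite (le_trans (normc_le_ReIm _))//= mulr_natl mulr2n lerD// ler_norml;
    apply/andP.
have [<-|<-] : `|x| = r \/ `|y| = r.
  by case: h => ->; [left|left|right|right]; rewrite ?normrN gtr0_norm.
- exact: (normc_Re (x +i* y)%C).
- exact: (normc_Im (x +i* y)%C).
Qed.

Lemma on_square_edge_neq0 r z : 0 < r -> on_edge (- r) r (- r) r z -> z != 0.
Proof.
move=> r0 /(on_square_edge_norm r0)/andP[h _].
by rewrite -normc_gt0 (lt_le_trans r0).
Qed.

(** The square minus a small concentric square splits into four rectangles that
avoid the origin and contribute nothing by Goursat's theorem. On the boundary
of the small square the function is bounded by a small multiple of the inverse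
of the side, while the perimeter is a multiple of the side. *)
Lemma rint_punctured G r : 0 < r ->
  (forall x y, - r <= x <= r -> - r <= y <= r -> (x +i* y)%C != 0 ->
    derivable G (x +i* y)%C 1) ->
  (forall e : R, 0 < e -> exists2 d : R, 0 < d &
    forall z, z != 0 -> N z < d -> N (z * G z) <= e) ->
  rint G (- r) r (- r) r = 0.
Proof.
move=> r0 hG sG; apply: Normc.eq0_normc; apply/eqP;
  rewrite eq_le normc_ge0 andbT.
have small (e : R) : 0 < e -> N (rint G (- r) r (- r) r) <= 16 * e.
  move=> e0; have [d d0 hd] := sG e e0.
  pose s := Num.min (r / 2) (d / 4).
  have s0 : 0 < s by rewrite lt_min !divr_gt0.
  have sr : s < r by rewrite gt_min; apply/orP; left; lra.
  have sd : 2 * s < d.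
    have : s <= d / 4 by rewrite ge_min lexx orbT.
    by move=> ?; lra.
  have E x0 x1 y0 y1 : - r <= x0 -> x1 <= r -> - r <= y0 -> y1 <= r ->
      x0 != 0 -> x1 != 0 -> y0 != 0 -> y1 != 0 -> cont_edges G x0 x1 y0 y1.
    move=> a b c f nx0 nx1 ny0 ny1 [x y] [xs ys xy].
    apply: derivableC_continuous; apply: hG; [lra|lra|].
    rewrite eq_complex negb_and /=.
    by case: xy => ->; apply/orP; tauto.
  have Z x0 x1 y0 y1 : x0 <= x1 -> y0 <= y1 ->
      - r <= x0 -> x1 <= r -> - r <= y0 -> y1 <= r ->
      [|| x1 < 0, 0 < x0, y1 < 0 | 0 < y0] -> rint G x0 x1 y0 y1 = 0.
    move=> xx yy a b c f o; apply: goursat => // x y xs ys.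
    apply: hG; [lra|lra|]; rewrite eq_complex negb_and /=; apply/orP.
    by case/or4P: o => o; [left|left|right|right]; apply/eqP => ?; lra.
  have rn0 : r != 0 by rewrite gt_eqF.
  have sn0 : s != 0 by rewrite gt_eqF.
  have rN0 : - r != 0 by rewrite oppr_eq0.
  have sN0 : - s != 0 by rewrite oppr_eq0.
  have -> : rint G (- r) r (- r) r = rint G (- s) s (- s) s.
    rewrite (@rint_splitx _ _ (- r) (- s) r); [|lra|lra|apply: E => //;
      lra|apply: E => //; lra].
    rewrite (Z (- r) (- s)) ?add0r; [|lra|lra|lra|lra|lra|lra|by rewrite
      oppr_lt0 s0].
    rewrite (@rint_splitx _ _ (- s) s r); [|lra|lra|apply: E => //;
      lra|apply: E => //; lra].
    rewrite (Z s r) ?addr0; [|lra|lra|lra|lra|lra|lra|by rewrite s0 orbT].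
    rewrite (@rint_splity _ _ _ _ (- r) (- s) r); [|lra|lra|apply: E => //;
      lra|apply: E => //; lra].
    rewrite (Z _ _ (- r) (- s)) ?add0r; [|lra|lra|lra|lra|lra|lra|by rewrite
      (oppr_lt0 s) s0 !orbT].
    rewrite (@rint_splity _ _ _ _ (- s) s r); [|lra|lra|apply: E => //;
      lra|apply: E => //; lra].
    rewrite (Z _ _ s r) ?addr0; [by []|lra|lra|lra|lra|lra|lra|by rewrite s0
      !orbT].
  have -> : 16 * e = 4 * (e / s) * ((s - - s) + (s - - s)) by field;
    rewrite sn0.
  apply: rint_bound; [lra|lra|apply: E => //; lra|].
  move=> z hz; have /andP[z1 z2] := on_square_edge_norm s0 hz.
  have z0 := on_square_edge_neq0 s0 hz.
  have := hd z z0 (le_lt_trans z2 sd); rewrite Normc.normcM => hz'.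
  by rewrite ler_pdivlMr// mulrC (le_trans _ hz')// ler_wpM2r// normc_ge0.
rewrite leNgt; apply/negP; set K := N _ in small * => K0.
have := small (K / 32); rewrite divr_gt0// => /(_ isT) ?; lra.
Qed.

Lemma derivable_invC (z : C) : z != 0 -> derivable (fun w : C => w^-1) z 1.
Proof. by move=> z0; apply: derivableV => //; exact: derivable_id. Qed.

Lemma continuous_invC (z : C) : z != 0 -> {for z, continuous
  (fun w : C => w^-1)}.
Proof. by move=> /derivable_invC/derivableC_continuous. Qed.

(** Cauchy's constant [2 * pi * 'i]. *)
Definition winding r : C := rint (fun z => z^-1) (- r) r (- r) r.

(** Each pair of opposite sides contributes ['i] times the integral of the
positive function [2 r / (r ^+ 2 + t ^+ 2)]. *)
Lemma winding_neq0 r : 0 < r -> winding r != 0.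
Proof.
move=> r0; pose psi t : C := (r +i* t)%C^-1 - ((- r) +i* t)%C^-1.
have cpsi : cont_seg psi (- r) r.
  have hv (x : R) : x != 0 -> cont_seg (fun t => (x +i* t)%C^-1 : C) (- r) r.
    move=> x0 t _; apply: (@continuous_comp _ _ _ (fun t : R => (x +i* t)%C :
      C)).
      exact: continuous_vline.
    by apply: continuous_invC; rewrite eq_complex /= negb_and x0.
  by apply: cont_segB; apply: hv; rewrite ?oppr_eq0 gt_eqF.
have psiE t : psi t = ((2 * r / (r ^+ 2 + t ^+ 2)) +i* 0)%C.
  have n0 : r ^+ 2 + t ^+ 2 != 0 by rewrite gt_eqF// ltr_pwDl ?exprn_gt0//
    sqr_ge0.
  rewrite /psi /=; apply/eqP; rewrite eq_complex /= sqrrN; apply/andP; split;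
    apply/eqP; field; by rewrite ?n0.
have wE : winding r = 'i%C * cint psi (- r) r + 'i%C * cint psi (- r) r.
  rewrite /winding /rint; congr (_ + _).
  rewrite -(cintZ _ cpsi); apply: eq_cint => t _.
  have n0 : r ^+ 2 + t ^+ 2 != 0 by rewrite gt_eqF// ltr_pwDl ?exprn_gt0//
    sqr_ge0.
  have n1 : t ^+ 2 + r ^+ 2 != 0 by rewrite addrC.
  by rewrite psiE; apply/eqP; rewrite eq_complex /= sqrrN; apply/andP; split;
    apply/eqP; field; rewrite ?n0 ?n1.
have ge2 : 2 <= complex.Re (cint psi (- r) r).
  have -> : 2 = r^-1 * (r - - r) by field; rewrite gt_eqF.
  apply: cint_Re_ge => //; first lra.
  move=> t /andP[t1 t2]; rewrite psiE /=.
  have n0 : 0 < r ^+ 2 + t ^+ 2 by rewrite ltr_pwDl ?exprn_gt0// sqr_ge0.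
  rewrite ler_pdivlMr// ler_pdivrMl//.
  have : 0 <= (r - t) * (r + t) by apply: mulr_ge0; lra.
  have -> : (r - t) * (r + t) = r ^+ 2 - t ^+ 2 by ring.
  have -> : r * (2 * r) = r ^+ 2 + r ^+ 2 by ring.
  by rewrite subr_ge0 lerD2l.
rewrite wE; move: ge2; case: (cint _ _ _) => p q /= p2.
rewrite eq_complex /= negb_and; apply/orP; right; apply/eqP; lra.
Qed.

(** Cauchy's formula for the first derivative at the origin: the integral of
[G z / z ^+ 2] along the boundary of the square of half-side [r], normalised.
The radius being fixed, the formula is applied at varying centres by
translating the function. *)
Definition dkernel r G : C :=
  (winding r)^-1 * rint (fun z => z^-1 ^+ 2 * G z) (- r) r (- r) r.

Definition cont_square r G := cont_edges G (- r) r (- r) r.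

Lemma cont_square_kernel r G : 0 < r -> cont_square r G ->
  cont_square r (fun z => z^-1 ^+ 2 * G z).
Proof.
move=> r0 h z hz; have z0 := on_square_edge_neq0 r0 hz.
have cz := continuous_invC z0.
apply: (@cvgM C C (nbhs z) _ (fun w : C => w^-1 ^+ 2) G); last exact: h.
by apply: (@cvgM C C (nbhs z) _ (fun w : C => w^-1) (fun w : C => w^-1)).
Qed.

Lemma dkernelB r G H : 0 < r -> cont_square r G -> cont_square r H ->
  dkernel r (fun z => G z - H z) = dkernel r G - dkernel r H.
Proof.
move=> r0 hG hH; have rr : - r <= r by lra.
rewrite /dkernel -mulrBr; congr (_ * _).
rewrite -(rintB rr rr (cont_square_kernel r0 hG) (cont_square_kernel r0 hH)).
by apply: eq_rint => // z _; rewrite mulrBr.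
Qed.

Lemma dkernelZ r c G : 0 < r -> cont_square r G ->
  dkernel r (fun z => c * G z) = c * dkernel r G.
Proof.
move=> r0 hG; have rr : - r <= r by lra.
rewrite /dkernel mulrCA; congr (_ * _).
rewrite -(rintZ c rr rr (cont_square_kernel r0 hG)).
by apply: eq_rint => // z _; rewrite mulrCA.
Qed.

Definition dkernel_bound r : R := N (winding r)^-1 * (16 / r).

Lemma dkernel_bound_gt0 r : 0 < r -> 0 < dkernel_bound r.
Proof.
move=> r0; rewrite /dkernel_bound mulr_gt0 ?divr_gt0//.
by rewrite normc_gt0 invr_eq0 winding_neq0.
Qed.

Lemma le_dkernel r G (M : R) : 0 < r -> cont_square r G ->
  (forall z, on_edge (- r) r (- r) r z -> N (G z) <= M) ->
  N (dkernel r G) <= dkernel_bound r * M.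
Proof.
move=> r0 hG hM; have rr : - r <= r by lra.
rewrite /dkernel Normc.normcM /dkernel_bound -mulrA ler_wpM2l ?normc_ge0//.
have -> : 16 / r * M = 4 * (r^-1 ^+ 2 * M) * ((r - - r) + (r - - r)).
  by field; rewrite gt_eqF.
apply: (rint_bound rr rr (cont_square_kernel r0 hG)).
move=> z hz; have /andP[z1 _] := on_square_edge_norm r0 hz.
rewrite Normc.normcM expr2 Normc.normcM Normc.normcV -expr2.
apply: ler_pM; rewrite ?normc_ge0 ?sqr_ge0//; last exact: hM.
by rewrite ler_sqr ?nnegrE ?invr_ge0 ?normc_ge0 ?(ltW r0)// lef_pV2// posrE
  (lt_le_trans r0).
Qed.

(** The function [(G z - G 0) / z ^+ 2 - G'(0) / z] is holomorphic off the
origin, and its product with [z] tends to zero there by definition of the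
derivative, so it integrates to zero. *)
Lemma cauchy_derivative r G : 0 < r -> rect_holo G (- r) r (- r) r ->
  'D_1 G 0 = dkernel r (fun z => G z - G 0).
Proof.
move=> r0 hG; have rr : - r <= r by lra.
have w0 := winding_neq0 r0; set d := 'D_1 G 0.
have d0 : derivable G 0 1 by apply: hG; lra.
have cG : cont_square r G by exact: (rect_holo_edges hG).
have cB : cont_square r (fun z => G z - G 0).
  by move=> z hz; apply: (@cvgB C C C (nbhs z) _ G (cst (G 0)));
    [exact: cG|exact: cvg_cst].
have cI : cont_square r (fun z => z^-1).
  by move=> z hz; apply: continuous_invC; exact: on_square_edge_neq0 hz.
have cdI : cont_square r (fun z => d * z^-1).
  by move=> z hz; apply: (@cvgM C C (nbhs z) _ (cst d) (fun w => w^-1));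
    [exact: cvg_cst|exact: cI].
have : rint (fun z => z^-1 ^+ 2 * (G z - G 0) - d * z^-1) (- r) r (- r) r = 0.
  apply: (rint_punctured r0).
    move=> x y xs ys z0; have dz := hG x y xs ys;
      set z : C := (x +i* y)%C in z0 dz *.
    have dI := derivable_invC z0.
    have dK : derivable (fun w : C => w^-1 ^+ 2) z 1
      by exact: (derivableM dI dI).
    have dS : derivable (fun w : C => G w - G 0) z 1.
      by exact: (derivableB dz (derivable_cst (G 0) z 1)).
    have dL : derivable (fun w : C => d * w^-1) z 1.
      by exact: (derivableM (derivable_cst d z 1) dI).
    exact: (derivableB (derivableM dK dS) dL).
  move=> e e0; have [dd dd0 hd] := derivableC_remainder d0 e0;
    exists dd => // z z0.
  move=> zd; have := hd z; rewrite subr0 => /(_ zd) h.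
  have -> : z * (z^-1 ^+ 2 * (G z - G 0) - d * z^-1) = z^-1 * (G z - G 0 - z *
    d).
    by field.
  by rewrite Normc.normcM Normc.normcV ler_pdivrMl ?normc_gt0// [N z * e]mulrC.
rewrite (rintB rr rr (cont_square_kernel r0 cB) cdI) (rintZ d rr rr cI) => /eqP.
rewrite subr_eq0 => /eqP E.
by rewrite /dkernel E -/(winding r) mulrCA mulVf// mulr1.
Qed.

End CauchyKernel.

(** * Cauchy estimates and mean value inequality *)

Section CauchyEstimates.
Variable R : realType.
Local Notation C := (R[i]^o).
Local Notation N := (@Normc.normc R).
Implicit Types (g : C -> C) (z w h : C) (r : R).

Lemma shift_quotient g z0 z :
  (fun h : C => h^-1 *: (((fun w => g (w + z0)) \o shift z) (h *: (1 : C)) -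
     g (z + z0))) =
  (fun h : C => h^-1 *: ((g \o shift (z + z0)) (h *: (1 : C)) - g (z + z0))).
Proof. by apply/funext => h; rewrite /= addrA. Qed.

Lemma derivable_shift g z0 z : derivable g (z + z0) 1 ->
  derivable (fun w => g (w + z0)) z 1.
Proof. by move=> dg; rewrite /derivable shift_quotient. Qed.

Lemma derive_shift g z0 z : 'D_1 (fun w => g (w + z0)) z = 'D_1 g (z + z0).
Proof. by rewrite /derive shift_quotient. Qed.

Lemma cauchy_derivative_at r g z0 : 0 < r ->
  (forall z, N (z - z0) <= 2 * r -> derivable g z 1) ->
  'D_1 g z0 = dkernel r (fun z => g (z + z0) - g z0).
Proof.
move=> r0 hg; rewrite -[in LHS](add0r z0) -derive_shift.
rewrite (cauchy_derivative r0) ?add0r// => x y xs ys.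
apply: derivable_shift; apply: hg; rewrite addrK.
rewrite (le_trans (normc_le_ReIm _))//= mulr_natl mulr2n.
by apply: lerD; rewrite ler_norml; [exact: xs|exact: ys].
Qed.

Lemma cont_square_holo r g z0 : 0 < r ->
  (forall z, N (z - z0) <= 2 * r -> derivable g z 1) ->
  cont_square r (fun z => g (z + z0)).
Proof.
move=> r0 hg z /(on_square_edge_norm r0)/andP[_ zr].
by apply: derivableC_continuous; apply: derivable_shift; apply: hg;
  rewrite addrK.
Qed.

Lemma cont_square_cst r (c : C) : cont_square r (fun=> c).
Proof. by move=> z _; exact: (@cvg_cst C c C (nbhs z)). Qed.

Lemma cont_squareB r g1 g2 : cont_square r g1 -> cont_square r g2 ->
  cont_square r (fun z => g1 z - g2 z).
Proof.
by move=> h1 h2 z hz; apply: (@cvgB C C C (nbhs z) _ g1 g2);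
  [exact: h1|exact: h2].
Qed.

Lemma cont_squareZ r c g : cont_square r g -> cont_square r (fun z => c * g z).
Proof.
move=> h1 z hz; apply: (@cvgM C C (nbhs z) _ (cst c) g); last exact: h1.
exact: cvg_cst.
Qed.

Lemma cauchy_estimate r g z0 (M : R) : 0 < r ->
  (forall z, N (z - z0) <= 2 * r -> derivable g z 1 /\ N (g z) <= M) ->
  N ('D_1 g z0) <= dkernel_bound r * (2 * M).
Proof.
move=> r0 hg; have hd z (hz : N (z - z0) <= 2 * r) := (hg z hz).1.
rewrite (cauchy_derivative_at r0 hd).
have c1 := cont_squareB (cont_square_holo r0 hd) (@cont_square_cst r (g z0)).
apply: (le_dkernel r0 c1) => z /(on_square_edge_norm r0)/andP[_ zr].
rewrite (le_trans (normcB _ _))// mulr_natl mulr2n; apply: lerD.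
  by apply: (hg _ _).2; rewrite addrK.
by apply: (hg _ _).2; rewrite subrr Normc.normc0 mulr_ge0// ltW.
Qed.

Lemma is_derive_real_distP (V : normedModType R) (u : V -> R) (p v : V)
  (l : R) :
  (forall e : R, 0 < e -> exists2 d : R, 0 < d &
    forall h : R, h != 0 -> `|h| < d -> `|h^-1 * (u (h *: v + p) - u p) - l| <
      e) ->
  is_derive p v u l.
Proof.
move=> H.
have cv : h^-1 *: (u (h *: v + p) - u p) @[h --> 0^'] --> l.
  apply/cvgrPdist_lt => e e0; have [d d0 hd] := H e e0.
  apply/nbhs_ballP; exists d => // t; rewrite /ball/= sub0r normrN => td t0.
  by rewrite distrC; exact: hd.
by apply: DeriveDef; [apply/cvg_ex; exists l|exact: cvg_lim].
Qed.

(** Real mean value theorem along the segment, for the real and for the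
imaginary part; hence the factor 2. *)
Lemma mean_value_estimate g z w (L : R) :
  (forall t : R, 0 <= t <= 1 -> derivable g (z + t%:C%C * (w - z)) 1 /\
    N ('D_1 g (z + t%:C%C * (w - z))) <= L) ->
  N (g w - g z) <= 2 * L * N (w - z).
Proof.
move=> hg; pose k := w - z; pose pt (t : R) : C := z + t%:C%C * k.
(* Common treatment of [Re] and [Im]: a real-linear form of norm at most 1. *)
have key (p : C -> R) (pB : {morph p : a b / a - b})
    (pZ : forall (a : R) b, p (a%:C%C * b) = a * p b) (pN : forall a, `|p a| <=
      N a) :
    `|p (g w) - p (g z)| <= L * N k.
  have der (t : R) : 0 <= t <= 1 ->
      is_derive t 1 (fun t : R => p (g (pt t))) (p (k * 'D_1 g (pt t))).
    move=> /hg[dg _]; apply: is_derive_real_distP => e e0.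
    have e1 : 0 < e / (N k + 1) by rewrite divr_gt0// ltr_wpDl// normc_ge0.
    have [d d0 hd] := derivableC_remainder dg e1.
    exists (d / (N k + 1)); first by rewrite divr_gt0// ltr_wpDl// normc_ge0.
    move=> h h0 hlt.
    have ptE : pt (h *: 1 + t) - pt t = h%:C%C * k.
      by rewrite /pt [h *: 1]mulr1 rmorphD/=; ring.
    have nE : N (pt (h *: 1 + t) - pt t) = `|h| * N k
      by rewrite ptE Normc.normcM normc_real.
    have hk : `|h| * N k < d.
      rewrite (le_lt_trans (_ : _ <= `|h| * (N k + 1)))//.
        by rewrite ler_wpM2l// lerDl.
      by rewrite -ltr_pdivlMr// ltr_wpDl// normc_ge0.
    have := hd (pt (h *: 1 + t)); rewrite nE => /(_ hk);
      rewrite -/(pt t) ptE => hr.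
    have -> : h^-1 * (p (g (pt (h *: 1 + t))) - p (g (pt t))) - p (k * 'D_1 g
      (pt t)) =
       h^-1 * p (g (pt (h *: 1 + t)) - g (pt t) - h%:C%C * k * 'D_1 g (pt t)).
      by rewrite -[h%:C%C * k * _]mulrA !pB pZ [in RHS]mulrBr mulKf.
    rewrite normrM normfV ltr_pdivrMl ?normr_gt0//.
    rewrite (le_lt_trans (pN _))// (le_lt_trans hr)//.
    rewrite mulrCA ltr_pM2l ?normr_gt0// mulrAC -mulrA gtr_pMr// ltr_pdivrMr
      ?ltr_wpDl ?normc_ge0//.
    by rewrite mul1r ltrDl.
  have ct : {within `[0, 1], continuous (fun t => p (g (pt t)))}.
    apply: derivable_within_continuous => t; rewrite in_itv/= => t01.
    by have := der t t01 => -[].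
  have der' (t : R) : t \in `]0, 1[%R -> is_derive t 1 (fun t : R => p (g (pt
    t))) (p (k * 'D_1 g (pt t))).
    by rewrite in_itv/= => /andP[a b]; apply: der; rewrite !ltW.
  have [c] := MVT_segment ler01 der' ct; rewrite in_itv/= subr0 mulr1 => c01.
  have -> : pt 1 = w by rewrite /pt /k mul1r addrC subrK.
  have -> : pt 0 = z by rewrite /pt mul0r addr0.
  move=> ->; rewrite (le_trans (pN _))// Normc.normcM mulrC ler_wpM2r
    ?normc_ge0//.
  exact: (hg c c01).2.
rewrite (le_trans (normc_le_ReIm _))// !raddfB -mulrA mulr_natl mulr2n lerD//.
- apply: (key (@complex.Re R)); [exact: raddfB| |exact: normc_Re].
  by move=> a [b b'] /=; rewrite mul0r subr0.
- apply: (key (@complex.Im R)); [exact: raddfB| |exact: normc_Im].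
  by move=> a [b b'] /=; rewrite mul0r addr0.
Qed.

End CauchyEstimates.

(** * Mixed second derivatives in two complex variables *)

Section TwoVariables.
Variable R : realType.
Local Notation C := (R[i]^o).
Local Notation N := (@Normc.normc R).

(** The discs of radius [8 * r] used below leave room for squares of
half-side [r] (of radius at most [2 * r]) around points that are themselves
moved by such squares. *)
Definition bounded_holo (g : C -> C) (rho M : R) :=
  forall z, N z < rho -> derivable g z 1 /\ N (g z) <= M.

Lemma bounded_holo_derive (g : C -> C) (r M : R) : 0 < r ->
  bounded_holo g (8 * r) M ->
  forall z, N z <= 4 * r -> N ('D_1 g z) <= dkernel_bound r * (2 * M).
Proof.
move=> r0 hg z zr; apply: cauchy_estimate => // w wz; apply: hg.
rewrite -(subrK z w) (le_lt_trans (le_normcD _ _))//.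
rewrite (le_lt_trans (lerD wz zr))//; lra.
Qed.

Lemma normc_segment (z w : C) (b t : R) : N z <= b -> N w <= b -> 0 <= t <= 1 ->
  N (z + t%:C%C * (w - z)) <= b.
Proof.
move=> zb wb /andP[t0 t1].
have -> : z + t%:C%C * (w - z) = (1 - t)%:C%C * z + t%:C%C * w.
  by rewrite rmorphB/=; ring.
rewrite (le_trans (le_normcD _ _))// !Normc.normcM !normc_real.
rewrite !ger0_norm ?subr_ge0//.
have -> : b = (1 - t) * b + t * b by ring.
by apply: lerD; apply: ler_wpM2l; rewrite ?subr_ge0.
Qed.

Lemma bounded_holo_lipschitz (g : C -> C) (r M : R) : 0 < r ->
  bounded_holo g (8 * r) M ->
  forall z w, N z <= 4 * r -> N w <= 4 * r ->
  N (g w - g z) <= 4 * dkernel_bound r * M * N (w - z).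
Proof.
move=> r0 hg z w zr wr.
have -> : 4 * dkernel_bound r * M = 2 * (dkernel_bound r * (2 * M)) by ring.
apply: mean_value_estimate => t t01; have zt := normc_segment zr wr t01; split.
  by apply: (hg _ _).1; rewrite (le_lt_trans zt)// ltr_pM2r// ltr_nat.
exact: bounded_holo_derive zt.
Qed.

(** Cauchy's formula with the same square around [z] and around the origin
expresses the difference of the derivatives through [g (w + z) - g w], to
which the Lipschitz estimate applies. *)
Lemma bounded_holo_derive_lipschitz (g : C -> C) (r M : R) : 0 < r -> 0 <= M ->
  bounded_holo g (8 * r) M -> forall z, N z <= r ->
  N ('D_1 g z - 'D_1 g 0) <= 8 * dkernel_bound r ^+ 2 * M * N z.
Proof.
move=> r0 M0 hg z zr.
have hd z0 : N z0 <= r -> forall w, N (w - z0) <= 2 * r -> derivable g w 1.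
  move=> z0r w wz; apply: (hg _ _).1.
  rewrite -(subrK z0 w) (le_lt_trans (le_normcD _ _))//.
  rewrite (le_lt_trans (lerD wz z0r))//; lra.
have z0 : N 0 <= r by rewrite Normc.normc0 ltW.
rewrite (cauchy_derivative_at r0 (hd z zr)) (cauchy_derivative_at r0 (hd 0 z0)).
have cz := cont_squareB (cont_square_holo r0 (hd z zr)) (@cont_square_cst R r
  (g z)).
have c0 := cont_squareB (cont_square_holo r0 (hd 0 z0)) (@cont_square_cst R r
  (g 0)).
rewrite -(dkernelB r0 cz c0).
have -> : 8 * dkernel_bound r ^+ 2 * M * N z =
  dkernel_bound r * (2 * (4 * dkernel_bound r * M * N z)) by ring.
apply: (le_dkernel r0 (cont_squareB cz c0)) => w /(on_square_edge_norm
  r0)/andP[_ wr].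
have -> : g (w + z) - g z - (g (w + 0) - g 0) = (g (w + z) - g w) - (g z - g 0).
  by rewrite addr0; ring.
have le24 : 2 * r <= 4 * r by lra.
have le14 : r <= 4 * r by lra.
rewrite (le_trans (normcB _ _))// [leRHS]mulr_natl mulr2n; apply: lerD.
  have := @bounded_holo_lipschitz g r M r0 hg w (w + z);
    rewrite addrAC subrr add0r; apply.
    exact: le_trans wr le24.
  rewrite (le_trans (le_normcD _ _))// (le_trans (lerD wr zr))//; lra.
have := @bounded_holo_lipschitz g r M r0 hg 0 z; rewrite subr0; apply.
  exact: le_trans z0 le14.
exact: le_trans zr le14.
Qed.

(** Mean value inequality for [g z - z * g'(0)], whose derivative is
Lipschitz and vanishes at the origin. The constant depends only on [r] and
[M], which makes the estimate uniform over families of functions. *)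
Lemma bounded_holo_taylor (g : C -> C) (r M : R) : 0 < r -> 0 <= M ->
  bounded_holo g (8 * r) M -> forall h, N h <= r ->
  N (g h - g 0 - h * 'D_1 g 0) <= 16 * dkernel_bound r ^+ 2 * M * N h ^+ 2.
Proof.
move=> r0 M0 hg h hr; pose d := 'D_1 g 0.
have di (z : C) : derivable (fun z : C => z) z 1 by exact: derivable_id.
have dc (z : C) : derivable (fun _ : C => d) z 1 by exact: derivable_cst.
have dl (z : C) : derivable (fun z : C => z * d) z 1 := derivableM (di z) (dc
  z).
have dlE (z : C) : 'D_1 (fun z : C => z * d) z = d.
  apply: (etrans (deriveM (di z) (dc z))).
  have -> : 'D_1 (fun _ : C => d) z = 0 by exact: derive_cst.
  have -> : 'D_1 (fun z : C => z) z = 1 by exact: derive_id.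
  by rewrite scaler0 add0r [_ *: _]mulr1.
have := @mean_value_estimate R (fun z => g z - z * d) 0 h
  (8 * dkernel_bound r ^+ 2 * M * N h).
have -> : g h - h * d - (g 0 - 0 * d) = g h - g 0 - h * d by ring.
have -> : 16 * dkernel_bound r ^+ 2 * M * N h ^+ 2 =
  2 * (8 * dkernel_bound r ^+ 2 * M * N h) * N (h - 0) by rewrite subr0; ring.
apply => t /andP[t0 t1]; set z := 0 + _.
have zh : N z <= N h.
  rewrite /z add0r subr0 Normc.normcM normc_real ger0_norm//.
  by rewrite ler_piMl// normc_ge0.
have dg : derivable g z 1.
  apply: (hg _ _).1; rewrite (le_lt_trans zh)// (le_lt_trans hr)//; lra.
split; first exact: (derivableB dg (dl z)).
have -> : 'D_1 (fun z => g z - z * d) z = 'D_1 g z - d.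
  by rewrite -[in RHS](dlE z); exact: (deriveB dg (dl z)).
have := bounded_holo_derive_lipschitz r0 M0 hg (le_trans zh hr).
move=> /le_trans; apply; apply: ler_wpM2l zh.
by rewrite mulr_ge0// mulr_ge0// sqr_ge0.
Qed.

Lemma derivable_quadratic (g : C -> C) (l : C) (d K : R) : 0 < d -> 0 <= K ->
  (forall h, N h < d -> N (g h - g 0 - h * l) <= K * N h ^+ 2) -> derivable g 0
    1.
Proof.
move=> d0 K0 hg; apply/cvg_ex; exists l.
apply/cvg_dnbhs0C_distP => e e0; have K1 : 0 < K + 1 by rewrite ltr_wpDl.
exists (Num.min d (e / (K + 1))); first by rewrite lt_min d0 divr_gt0.
move=> h h0; rewrite lt_min ltr_pdivlMr// => /andP[hd he].
have hn : 0 < N h by rewrite normc_gt0.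
have -> : h^-1 *: (g (h *: 1 + 0) - g 0) - l = h^-1 * (g h - g 0 - h * l).
  by rewrite [h *: 1]mulr1 addr0 -[_ *: _]/(_ * _); field.
rewrite Normc.normcM Normc.normcV ltr_pdivrMl// (le_lt_trans (hg h hd))//.
rewrite expr2 mulrA [ltRHS]mulrC ltr_pM2r// (le_lt_trans _ he)// mulrC.
by rewrite ler_wpM2l ?normc_ge0// lerDl.
Qed.

(** A weak form of Hartogs' theorem. Cauchy's formula in [t] writes the
derivative of [F s] at the origin as an integral of values of [F s]. Its
difference quotients in [s] converge because those of [F] converge at a
quadratic rate that is uniform in [t]; the limit is the same integral of the
[s]-derivative of [F]. *)
Lemma separately_holo_derive (F : C -> C -> C) (r M : R) : 0 < r -> 0 <= M ->
  (forall t, N t < 8 * r -> bounded_holo (F^~ t) (8 * r) M) ->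
  (forall s, N s < 8 * r -> bounded_holo (F s) (8 * r) M) ->
  derivable (fun s => 'D_1 (F s) 0) 0 1.
Proof.
move=> r0 M0 hs ht; pose B := dkernel_bound r; have B0 := dkernel_bound_gt0 r0.
have lt28 : 2 * r < 8 * r by lra.
have le24 : 2 * r <= 4 * r by lra.
have lt18 : r < 8 * r by lra.
have N00 : N 0 = 0 := Normc.normc0 R.
have r8 : 0 < 8 * r by rewrite mulr_gt0.
pose g1 t := 'D_1 (F^~ t) 0.
have ds t : N t < 8 * r -> forall w, N (w - 0) <= 2 * r -> derivable (F^~ t) w
  1.
  by move=> tr w; rewrite subr0 => wr; apply: (hs t tr w _).1;
    exact: le_lt_trans wr lt28.
have dt s : N s < 8 * r -> forall w, N (w - 0) <= 2 * r -> derivable (F s) w 1.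
  by move=> sr w; rewrite subr0 => wr; apply: (ht s sr w _).1;
    exact: le_lt_trans wr lt28.
have g1lip t t' : N t <= 4 * r -> N t' <= 4 * r ->
    N (g1 t' - g1 t) <= B * (2 * (4 * B * M * N (t' - t))).
  move=> tr t'r.
  have le48 : 4 * r < 8 * r by lra.
  have h := ds t (le_lt_trans tr le48); have h' := ds t' (le_lt_trans t'r le48).
  rewrite /g1 (cauchy_derivative_at r0 h) (cauchy_derivative_at r0 h').
  have c := cont_squareB (cont_square_holo r0 h) (@cont_square_cst R r (F 0 t)).
  have c' := cont_squareB (cont_square_holo r0 h') (@cont_square_cst R r (F 0
    t')).
  rewrite -(dkernelB r0 c' c).
  apply: (le_dkernel r0 (cont_squareB c' c)) => s /(on_square_edge_norm
    r0)/andP[_ sr].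
  rewrite addr0.
  have -> : F s t' - F 0 t' - (F s t - F 0 t) = (F s t' - F s t) - (F 0 t' - F
    0 t) by ring.
  rewrite (le_trans (normcB _ _))// [leRHS]mulr_natl mulr2n; apply: lerD.
    by apply: (bounded_holo_lipschitz r0 (ht s _)) => //;
      exact: le_lt_trans sr lt28.
  by apply: (bounded_holo_lipschitz r0 (ht 0 _)) => //; rewrite N00.
(* Continuity of the [s]-derivative in [t] makes the candidate limit
  meaningful. *)
have cg1 : cont_square r (fun t => g1 t - g1 0).
  apply: cont_squareB; last exact: cont_square_cst.
  move=> t /(on_square_edge_norm r0)/andP[_ tr].
  apply/continuousC_distP => e e0; pose K := B * (2 * (4 * B * M)) + 1.
  have K0 : 0 < K.
    rewrite ltr_wpDl//.
    by rewrite mulr_ge0 ?(ltW B0)// mulr_ge0// mulr_ge0// mulr_ge0// ltW.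
  exists (Num.min (2 * r) (e / K)); first by rewrite lt_min mulr_gt0// divr_gt0.
  move=> w; rewrite lt_min ltr_pdivlMr// => /andP[w1 w2].
  have wr : N w <= 4 * r.
    rewrite -(subrK t w) (le_trans (le_normcD _ _))// (le_trans (lerD (ltW w1)
      tr))//; lra.
  rewrite (le_lt_trans (g1lip _ _ (le_trans tr le24) wr))//.
  rewrite (le_lt_trans _ w2)// -subr_ge0.
  by rewrite (_ : _ - _ = N (w - t)) ?normc_ge0// /K; ring.
pose l := dkernel r (fun t => g1 t - g1 0).
apply: (@derivable_quadratic _ l r (B * (2 * (16 * B ^+ 2 * M)))) => //.
  by rewrite mulr_ge0 ?(ltW B0)// mulr_ge0// mulr_ge0// mulr_ge0// sqr_ge0.
move=> h hr.
have h8 : N h < 8 * r by exact: lt_trans hr lt18.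
have z8 : N 0 < 8 * r by rewrite N00.
rewrite (cauchy_derivative_at r0 (dt h h8)) (cauchy_derivative_at r0 (dt 0 z8)).
have ch := cont_squareB (cont_square_holo r0 (dt h h8)) (@cont_square_cst R r
  (F h 0)).
have c0 := cont_squareB (cont_square_holo r0 (dt 0 z8)) (@cont_square_cst R r
  (F 0 0)).
have cl := cont_squareZ (c:=h) cg1.
rewrite -(dkernelB r0 ch c0) /l -(dkernelZ h r0 cg1).
rewrite -(dkernelB r0 (cont_squareB ch c0) cl).
have -> : B * (2 * (16 * B ^+ 2 * M)) * N h ^+ 2 =
  B * (2 * (16 * B ^+ 2 * M * N h ^+ 2)) by ring.
apply: (le_dkernel r0 (cont_squareB (cont_squareB ch c0) cl)).
move=> t /(on_square_edge_norm r0)/andP[_ tr]; rewrite (addr0 t).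
have E (a b c d k p q : C) : a - b - (c - d) - k * (p - q) =
  (a - c - k * p) - (b - d - k * q) by ring.
rewrite E.
rewrite (le_trans (normcB _ _))// [leRHS]mulr_natl mulr2n; apply: lerD.
  exact: (bounded_holo_taylor r0 M0 (hs t (le_lt_trans tr lt28)) (ltW hr)).
exact: (bounded_holo_taylor r0 M0 (hs 0 z8) (ltW hr)).
Qed.

End TwoVariables.

(** * Second directional derivatives of holomorphic functions *)

Section DirectionalDerivatives.
Variables (R : realType) (V : normedModType R[i]).
Local Notation C := (R[i]^o).
Local Notation N := (@Normc.normc R).
Implicit Types (f g : V -> C) (p q a b : V) (U : set V).

(** Turns properties of [f] near [p] into properties of functions of two complex
variables on a polydisc. *)
Lemma near_plane (P : set V) p a b : (\forall q \near p, P q) ->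
  exists2 rho : R, 0 < rho &
  forall s t : C, N s < rho -> N t < rho -> P (s *: a + (t *: b + p)).
Proof.
move=> /nbhs_ballP[/= e /gt0CE[e0 ee] eP].
pose n (w : V) : R := complex.Re `|w|.
have nE (w : V) : `|w| = (n w)%:C%C by rewrite RRe_real// normr_real.
have n0 (w : V) : 0 <= n w by rewrite -ler0c -nE.
have S0 : 0 < n a + n b + 1 by rewrite ltr_wpDl// addr_ge0.
exists (complex.Re e / (n a + n b + 1)); first by rewrite divr_gt0.
move=> s t; rewrite !ltr_pdivlMr// => hs ht; apply: eP.
rewrite -ball_normE /ball_/= ee distrC addrA addrK.
rewrite (le_lt_trans (ler_normD _ _))// !normrZ !nE !normCE -!rmorphM -rmorphD
  ltcR.
have [m0 m1] : 0 <= N s /\ 0 <= N t by rewrite !normc_ge0.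
have na := n0 a; have nb := n0 b.
have [st|ts] := leP (N s) (N t).
  rewrite (le_lt_trans _ ht)// !mulrDr mulr1 -[leLHS]addr0 lerD// lerD2r.
  exact: ler_wpM2r.
rewrite (le_lt_trans _ hs)// !mulrDr mulr1 -[leLHS]addr0 lerD// lerD2l.
by apply: ler_wpM2r => //; exact: ltW.
Qed.

Lemma derivable_line f p a (s : C) : derivable f (s *: a + p) a ->
  derivable (fun t : C => f (t *: a + p)) s 1.
Proof.
move=> /derivable1P df.
pose g (w : C) := f (w *: a + (s *: a + p)).
have -> : (fun t : C => f (t *: a + p)) = (fun t => g (t + - s)).
  by apply/funext => t; rewrite /g addrA -scalerDl subrK.
by apply: derivable_shift; rewrite subrr.
Qed.

Lemma derive_line f p a : 'D_1 (fun t : C => f (t *: a + p)) 0 = 'D_a f p.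
Proof.
have E : (fun h : C => h^-1 *:
      (((fun t : C => f (t *: a + p)) \o shift 0) (h *: (1 : C)) - f (0 *: a +
        p))) =
    (fun h => h^-1 *: ((f \o shift p) (h *: a) - f p)).
  by apply/funext => h /=; rewrite addr0 scale0r add0r [h *: 1]mulr1.
by rewrite /derive E.
Qed.

(** Complex differentiability at order one already gives second derivatives
in all directions: the restriction of [f] to the plane spanned by [a] and [b]
is a bounded holomorphic function of two variables. *)
Lemma holomorphic_derive_derivable U f p a b : open U ->
  (forall q, U q -> differentiable f q) -> U p -> derivable ('D_b f) p a.
Proof.
move=> oU hf Up; pose M := N (f p) + 1.
have near : \forall q \near p, U q /\ N (f q) <= M.
  near=> q; split.
    by near: q; exact: open_nbhs_nbhs.
  rewrite -(subrK (f p) (f q)) (le_trans (le_normcD _ _))// addrC lerD2l ltW//.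
  near: q.
  have cf := differentiable_continuous (hf p Up).
  by have := (@cvgC_distP R V _ (nbhs_filter p) f (f p)).1 cf 1 ltr01.
have [rho rho0 hrho] := near_plane a b near.
pose F (s t : C) := f (s *: a + (t *: b + p)).
pose r := rho / 8; have r0 : 0 < r by rewrite divr_gt0.
have r8 : 8 * r = rho by rewrite /r; field.
have M0 : 0 <= M by rewrite addr_ge0// normc_ge0.
have := @separately_holo_derive R F r M r0 M0; rewrite r8.
have hs t : N t < rho -> bounded_holo (F^~ t) rho M.
  move=> tr s sr; have [Us Ms] := hrho s t sr tr; split=> //.
  by apply: derivable_line; apply: diff_derivable; exact: hf.
have FE s : F s = (fun t => f (t *: b + (s *: a + p))).
  by apply/funext => t; rewrite /F addrCA.
have ht s : N s < rho -> bounded_holo (F s) rho M.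
  move=> sr t tr; have [Us Ms] := hrho s t sr tr; split=> //.
  rewrite FE; apply: derivable_line; apply: diff_derivable; apply: hf.
  by rewrite addrCA.
move=> /(_ hs ht) dF; apply/derivable1P.
have E : (fun h : C => 'D_b f (h *: a + p)) = (fun s => 'D_1 (F s) 0).
  by apply/funext => s; rewrite FE derive_line.
by rewrite E; exact: dF.
Unshelve. all: by end_near.
Qed.

(** Being derivable in the single direction [a] over [R[i]] already controls the
direction ['i *: a], which is where the Cauchy-Riemann equations come from. *)
Lemma derive_scale_direction g p a (k : C) : derivable g p a ->
  'D_(k *: a) g p = k * 'D_a g p.
Proof.
move=> dg; apply: derive_unique => e e0.
have K0 : 0 < N k + 1 by rewrite ltr_wpDl// normc_ge0.
have e1 : 0 < e / (N k + 1) by rewrite divr_gt0.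
have [d d0 hd] := derivable_remainder dg e1.
exists (d / (N k + 1)); first by rewrite divr_gt0.
move=> h h0 hlt; have hn : 0 < N h by rewrite normc_gt0.
have hk : N (h * k) < d.
  rewrite Normc.normcM (le_lt_trans (_ : _ <= N h * (N k + 1)))//.
    by rewrite ler_wpM2l ?normc_ge0// lerDl.
  by rewrite -ltr_pdivlMr.
have := hd (h * k) hk; rewrite scalerA => hr.
have E (x y D : C) : h^-1 * (x - y) - k * D = h^-1 * (x - y - h * k * D)
  by field.
rewrite E Normc.normcM Normc.normcV ltr_pdivrMl// (le_lt_trans hr)//.
rewrite Normc.normcM mulrCA ltr_pM2l// mulrAC -mulrA gtr_pMr//.
by rewrite ltr_pdivrMr// mul1r ltrDl.
Qed.

Lemma derive_scale_function g p a (k : C) : derivable g p a ->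
  'D_a (fun q => k * g q) p = k * 'D_a g p.
Proof. by move=> dg; exact: (deriveZ k dg). Qed.

(** Along a real line, the derivative of the real (or imaginary) part of [G]
is the real (or imaginary) part of the complex derivative; [phi] is this part
read in real coordinates, and [rho] stands for [Re] or [Im]. *)
Lemma is_derive_real_part (W : normedModType R) (G : V -> C) (z w : V)
    (rho : C -> R) (phi : W -> R) (q e : W) :
  {morph rho : s t / s - t} -> (forall (s : R) t, rho (s%:C%C * t) = s * rho t)
    ->
  (forall t, `|rho t| <= N t) -> derivable G z w ->
  (exists2 d : R, 0 < d & forall h : R, `|h| < d ->
     phi (h *: e + q) = rho (G (h%:C%C *: w + z))) ->
  'D_e phi q = rho ('D_w G z).
Proof.
move=> rB rZ rN dG [d0 d00 hphi]; apply: derive_val.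
apply: is_derive_real_distP => eps eps0.
have eps1 : 0 < eps / 2 by rewrite divr_gt0.
have [d d1 hd] := derivable_remainder dG eps1.
exists (Num.min d0 d); first by rewrite lt_min d00.
move=> h h0; rewrite lt_min => /andP[h1 h2].
have hh := hphi h h1.
have h3 : phi q = rho (G z).
  by have := hphi 0; rewrite normr0 scale0r add0r rmorph0 scale0r add0r; apply.
have := hd h%:C%C; rewrite normc_real => /(_ h2) hr.
have E : h^-1 * (phi (h *: e + q) - phi q) - rho ('D_w G z) =
    h^-1 * rho (G (h%:C%C *: w + z) - G z - h%:C%C * 'D_w G z).
  by rewrite hh h3 !rB rZ [in RHS]mulrBr mulKf.
rewrite E normrM normfV ltr_pdivrMl ?normr_gt0// (le_lt_trans (rN _))//.
rewrite (le_lt_trans hr)// mulrC ltr_pM2l ?normr_gt0//; lra.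
Qed.

End DirectionalDerivatives.

(** * The block determinant *)

Section Determinant.
Variable R : realType.
Local Notation N := (@Normc.normc R).

Lemma normcX2 (z : R[i]) : (N z ^+ 2)%:C%C = z * z^*%C.
Proof. by rewrite -sqr_normc normCE rmorphXn. Qed.

(** Adding [- 'i] times the lower rows to the upper ones, then [- 'i] times
the left columns to the right ones, makes the matrix block triangular with
diagonal blocks [W] and minus the conjugate of [W]. *)
Lemma det_re_im_block m (W : 'M[R[i]]_m) :
  \det (block_mx (map_mx (@complex.Re R) W) (- map_mx (@complex.Im R) W)
          (- map_mx (@complex.Im R) W) (- map_mx (@complex.Re R) W)) =
  (-1) ^+ m * N (\det W) ^+ 2.
Proof.
set P := map_mx (@complex.Re R) W; set Q := map_mx (@complex.Im R) W.
pose cP := map_mx (real_complex R) P; pose cQ := map_mx (real_complex R) Q.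
have WE : W = cP + 'i%C *: cQ.
  by apply/matrixP => j k; rewrite !mxE -complexE.
have WJ : map_mx conjc W = cP - 'i%C *: cQ.
  apply/matrixP => j k; rewrite !mxE; case: (W j k) => a b.
  by apply/eqP; rewrite eq_complex /=; apply/andP; split; apply/eqP; ring.
have ii : 'i%C * 'i%C = -1 :> R[i] by rewrite -expr2 sqr_i.
pose X : 'M[R[i]]_(m + m) := block_mx 1%:M (- 'i%C)%:M 0 1%:M.
have detX : \det X = 1 by rewrite /X det_ublock !det1 mulr1.
have E1 : X *m block_mx cP (- cQ) (- cQ) (- cP) =
    block_mx W ('i%C *: W) (- cQ) (- cP).
  rewrite /X mulmx_block; congr block_mx.
  - by rewrite mul1mx mul_scalar_mx scalerN scaleNr opprK WE.
  - rewrite mul1mx mul_scalar_mx scalerN scaleNr opprK WE scalerDr scalerA ii.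
    by rewrite scaleN1r addrC.
  - by rewrite mul0mx mul1mx add0r.
  - by rewrite mul0mx mul1mx add0r.
have E2 : block_mx W ('i%C *: W) (- cQ) (- cP) *m X =
    block_mx W 0 (- cQ) (- map_mx conjc W).
  rewrite /X mulmx_block; congr block_mx.
  - by rewrite mulmx1 mulmx0 addr0.
  - by rewrite mulmx1 mul_mx_scalar scaleNr addNr.
  - by rewrite mulmx1 mulmx0 addr0.
  - by rewrite mulmx1 mul_mx_scalar scalerN scaleNr opprK WJ opprB addrC.
have D : \det (block_mx cP (- cQ) (- cQ) (- cP)) =
    (-1) ^+ m * (\det W * (\det W)^*%C).
  have := congr1 determinant E2; rewrite -E1 !det_mulmx detX mul1r mulr1 => ->.
  rewrite det_lblock -scaleN1r detZ mulrCA; congr (_ * (_ * _)).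
  exact: (det_map_mx (@conjc R)).
apply: complexI; rewrite -det_map_mx map_block_mx !map_mxN -/cP -/cQ D.
by rewrite -normcX2 -(rmorphN1 (real_complex R)) -rmorphXn -rmorphM.
Qed.

Lemma det_hessian_block m (A : 'M[R[i]]_m) (t1 t2 : R) :
  let W := (t1 -i* t2)%C *: A in
  \det (block_mx (map_mx (@complex.Re R) W) (- map_mx (@complex.Im R) W)
          (- map_mx (@complex.Im R) W) (- map_mx (@complex.Re R) W)) =
  (-1) ^+ m * (t1 ^+ 2 + t2 ^+ 2) ^+ m * N (\det A) ^+ 2.
Proof.
move=> W; rewrite det_re_im_block -mulrA; congr (_ * _).
rewrite /W detZ Normc.normcM exprMn; congr (_ * _).
have NX k (z : R[i]) : N (z ^+ k) = N z ^+ k.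
  by elim: k => [|k IH]; rewrite ?expr0 ?Normc.normc1// !exprS Normc.normcM IH.
rewrite NX -exprM mulnC exprM; congr (_ ^+ _).
by rewrite /= sqrrN sqr_sqrtr// addr_ge0// sqr_ge0.
Qed.

End Determinant.

(** * Real Hessians of the real and imaginary parts *)

Section RealHessian.
Variables (R : realType) (m : nat).
Local Notation C := (R[i]^o).
Local Notation N := (@Normc.normc R).

(** The identification of pairs of real vectors with complex vectors; it is
real-linear and sends the last [m] basis vectors to ['i] times the first
ones. *)
Definition complexify (q : 'rV[R]_(m + m)) : 'rV[C]_m :=
  complex_row (lsubmx q) (rsubmx q).

Lemma complexify_row_mx (x y : 'rV[R]_m) :
  complexify (row_mx x y) = complex_row x y.
Proof. by rewrite /complexify row_mxKl row_mxKr. Qed.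

Lemma complexify_line (h : R) (e q : 'rV[R]_(m + m)) :
  complexify (h *: e + q) = h%:C%C *: complexify e + complexify q.
Proof.
apply/rowP => j; rewrite !mxE.
by apply/eqP; rewrite eq_complex /=; apply/andP; split; apply/eqP; ring.
Qed.

Lemma complexify_lshift (j : 'I_m) :
  complexify (delta_mx 0 (lshift m j)) = delta_mx 0 j.
Proof.
apply/rowP => k; rewrite !mxE !eqxx /= (inj_eq (@lshift_inj _ _)) eq_rlshift.
by case: (k == j).
Qed.

Lemma complexify_rshift (j : 'I_m) :
  complexify (delta_mx 0 (rshift m j)) = 'i%C *: delta_mx 0 j.
Proof.
apply/rowP => k; rewrite !mxE !eqxx /= (inj_eq (@rshift_inj _ _)) eq_lrshift.
by case: (k == j); rewrite ?mulr1 ?mulr0.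
Qed.

Section RealPart.
Variables (U : set 'rV[C]_m) (f : 'rV[C]_m -> C).
Variables (rho : C -> R) (phi : 'rV[R]_(m + m) -> R).
Hypothesis oU : open U.
Hypothesis hf : forall z, U z -> differentiable f z.
Hypothesis rhoB : {morph rho : s t / s - t}.
Hypothesis rhoZ : forall (s : R) t, rho (s%:C%C * t) = s * rho t.
Hypothesis rhoN : forall t, `|rho t| <= N t.
Hypothesis phiE : forall q, U (complexify q) -> phi q = rho (f (complexify q)).

Lemma complexify_near q e : U (complexify q) ->
  exists2 d : R, 0 < d & forall h : R, `|h| < d -> U (complexify (h *: e + q)).
Proof.
move=> Uq; have nU : \forall z \near complexify q, U z by exact: open_nbhs_nbhs.
have [d d0 hd] := near_plane (complexify e) 0 nU; exists d => // h hlt.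
have := hd h%:C%C 0; rewrite scaler0 add0r -complexify_line; apply.
  by rewrite normc_real.
by rewrite Normc.normc0.
Qed.

Lemma derive_real_part q e : U (complexify q) ->
  'D_e phi q = rho ('D_(complexify e) f (complexify q)).
Proof.
move=> Uq; apply: (is_derive_real_part rhoB rhoZ rhoN).
  exact: diff_derivable (hf Uq).
have [d d0 hd] := complexify_near e Uq; exists d => // h /hd Uh.
by rewrite -complexify_line; exact: phiE.
Qed.

(** The first derivatives agree on a whole neighbourhood of [q], so they can be
differentiated again. *)
Lemma derive2_real_part q e1 e2 : U (complexify q) ->
  'D_e1 ('D_e2 phi) q =
  rho ('D_(complexify e1) ('D_(complexify e2) f) (complexify q)).
Proof.
move=> Uq; apply: (is_derive_real_part rhoB rhoZ rhoN).
  exact: holomorphic_derive_derivable oU hf Uq.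
have [d d0 hd] := complexify_near e1 Uq; exists d => // h /hd Uh.
by rewrite -complexify_line; exact: derive_real_part.
Qed.

Lemma derive2_scalel z (a b : 'rV[C]_m) (k : C) : U z ->
  'D_(k *: a) ('D_b f) z = k * 'D_a ('D_b f) z.
Proof.
move=> Uz; apply: derive_scale_direction.
exact: holomorphic_derive_derivable oU hf Uz.
Qed.

Lemma derive2_scaler z (a b : 'rV[C]_m) (k : C) : U z ->
  'D_a ('D_(k *: b) f) z = k * 'D_a ('D_b f) z.
Proof.
move=> Uz.
have dab : derivable ('D_b f) z a := holomorphic_derive_derivable oU hf Uz.
apply: etrans (derive_scale_function k dab); apply: near_eq_derive.
have : \forall w \near z, U w by exact: open_nbhs_nbhs.
apply: filterS => w Uw; apply: derive_scale_direction.
exact: diff_derivable (hf Uw).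
Qed.

(** Each derivative in an imaginary direction brings a factor ['i]. *)
Lemma hessian_real_part q : U (complexify q) ->
  let A := hessian f (complexify q) in
  hessian phi q = block_mx (map_mx rho A) (map_mx rho ('i%C *: A))
                    (map_mx rho ('i%C *: A)) (map_mx rho (- A)).
Proof.
have ii (w : C) : 'i%C * ('i%C * w) = - w by rewrite mulrA -expr2 sqr_i mulN1r.
move=> Uq A.
apply/matrixP => j k; rewrite mxE derive2_real_part//.
case: (split_ordP j) => {}j ->; case: (split_ordP k) => {}k ->.
- by rewrite block_mxEul !complexify_lshift !mxE.
- rewrite block_mxEur complexify_lshift complexify_rshift !mxE.
  exact: (congr1 rho (derive2_scaler _ _ _ Uq)).
- rewrite block_mxEdl complexify_lshift complexify_rshift !mxE.
  exact: (congr1 rho (derive2_scalel _ _ _ Uq)).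
- rewrite block_mxEdr !complexify_rshift !mxE; apply: (congr1 rho).
  apply: (etrans (derive2_scalel _ _ _ Uq)).
  exact: (etrans (congr1 ( *%R 'i%C) (derive2_scaler _ _ _ Uq)) (ii _)).
Qed.

End RealPart.

End RealHessian.

Theorem lemma1p5 (R : realType) (m : nat)
    (U : set 'rV[R[i]^o]_m) (f : 'rV[R[i]^o]_m -> R[i]^o)
    (u v : 'rV[R]_(m + m) -> R) :
  open U ->
  holomorphic_on U f ->
  (forall x y : 'rV[R]_m, U (complex_row x y) ->
     f (complex_row x y) = (u (row_mx x y) +i* v (row_mx x y))%C) ->
  forall (theta1 theta2 : R) (x y : 'rV[R]_m), U (complex_row x y) ->
    \det (theta1 *: hessian u (row_mx x y) + theta2 *: hessian v (row_mx x y)) =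
    (-1) ^+ m * (theta1 ^+ 2 + theta2 ^+ 2) ^+ m *
    Normc.normc (\det (hessian f (complex_row x y))) ^+ 2.
Proof.
move=> oU hf fE t1 t2 x y Uxy.
have fE' q : U (complexify q) -> f (complexify q) = (u q +i* v q)%C.
  by move=> /fE; rewrite hsubmxK.
have Uq : U (complexify (row_mx x y)) by rewrite complexify_row_mx.
have ReZ (s : R) (t : R[i]) : complex.Re (s%:C%C * t) = s * complex.Re t.
  by case: t => a b /=; rewrite mul0r subr0.
have ImZ (s : R) (t : R[i]) : complex.Im (s%:C%C * t) = s * complex.Im t.
  by case: t => a b /=; rewrite mul0r addr0.
have uE q : U (complexify q) -> u q = complex.Re (f (complexify q))
  by move=> /fE' ->.
have vE q : U (complexify q) -> v q = complex.Im (f (complexify q))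
  by move=> /fE' ->.
have hu := hessian_real_part oU hf (@raddfB _ _ (@complex.Re R)) ReZ (@normc_Re
  R) uE Uq.
have hv := hessian_real_part oU hf (@raddfB _ _ (@complex.Im R)) ImZ (@normc_Im
  R) vE Uq.
rewrite hu hv complexify_row_mx; move: (hessian f _) => A.
rewrite -(det_hessian_block A t1 t2) !scale_block_mx add_block_mx.
congr (\det (block_mx _ _ _ _)); apply/matrixP => j k; rewrite !mxE;
  case: (A j k) => a b /=; ring.
Qed.
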